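(* Let $A$ be a finite set of rational numbers with $|AA|\le K|A|$ and let $u\in\mathbb{Q}$ be non-zero. Then for every integer $k\ge2$, \[|(A+u)^{(k)}|\ge\frac{|A|^{k-1}}{K^k\left(2\binom{2k}{2}\right)^{Kk}}.\]
   Context: $AA=\{ab:a,b\in A\}$; $X^{(k)}=\{x_1\cdots x_k:x_i\in X\}$; $A+u=\{a+u:a\in A\}$. *)

(* Defs.v *)
From mathcomp Require Import all_boot all_order all_algebra.
From Stdlib Require Import Reals.
Set Implicit Arguments. Unset Strict Implicit. Unset Printing Implicit Defensive.
Import GRing.Theory.

Definition prodset (X Y : seq rat) : seq rat :=
  undup [seq GRing.mul x y | x : rat <- X, y : rat <- Y].

Fixpoint kprod (X : seq rat) (k : nat) : seq rat :=
  match k with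
  | 0 => [:: @GRing.one rat]
  | 1 => undup X
  | k'.+1 => prodset (kprod X k') X
  end.

Definition shift (A : seq rat) (u : rat) : seq rat :=
  undup [seq GRing.add a u | a : rat <- A].

Definition ncard (X : seq rat) : nat := size (undup X).

(* Main.v *)
Require Import Defs.
From mathcomp Require Import all_boot all_order all_algebra finmap zify.

(** After dilating, [u = 1]; discard [0] and [-1] from [A], and let [E] be the
number of solutions of [prod x_i = prod x'_i], [prod (1+x_i) = prod (1+x'_i)] in
[2k] variables from [A].  Cauchy-Schwarz and Pluennecke's inequality give
[|A|^(2k) <= |(A+1)^(k)| |A^(k)| E <= |(A+1)^(k)| K^k |A| E].

To bound [E], split [A] along a prime [p] by the sign and then by the value [j] of
the [p]-adic valuation.  Within one sign, [1+x] (or [1+1/x]) is congruent to [1]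
modulo [p^|j|] exactly, so in a solution the minimal [|j|] is attained at least
twice; choosing two such positions and applying Hoelder's inequality for [E]
gives [E(A)^(1/k) <= 2 C(2k,2) sum_j E(A_j)^(1/k)].  Each split lowers the affine
dimension [d] of the valuation vectors, so [E <= (2 (2 C(2k,2))^d |A|)^k], the
extra factor [2] accounting for the pairs [{x,-x}].

Freiman's lemma bounds [d].  If [|A| <= 30^K] the claim is trivial, and otherwise
[d <= K - 1/2]; the remaining factor [(2 C(2k,2))^(k/2)] absorbs the factor [2^k]
and the loss from discarding two elements. *)

Set Implicit Arguments. Unset Strict Implicit. Unset Printing Implicit Defensive.
Import Order.TTheory GRing.Theory Num.Theory.
Local Open Scope ring_scope.

(** * Cauchy-Schwarz in the natural numbers, and inclusion of multisets *)

Lemma cauchy_schwarz_nat (I : Type) (r : seq I) (a b : I -> nat) :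
  ((\sum_(i <- r) a i * b i) ^ 2 <=
   (\sum_(i <- r) a i ^ 2) * (\sum_(i <- r) b i ^ 2))%N.
Proof.
have E2 : forall c d : I -> nat, ((\sum_(i <- r) c i) * (\sum_(i <- r) d i) =
    \sum_(i <- r) \sum_(j <- r) c i * d j)%N.
  by move=> c d; rewrite big_distrl /=; apply: eq_bigr => i _; rewrite big_distrr.
(* Doubling and exchanging indices reduces the claim termwise to [2 x y <= x ^ 2 + y ^ 2] with
   [x = a i * b j] and [y = a j * b i]. *)
rewrite -(leq_pmul2l (isT : 0 < 2)%N) -mulnn !E2 mul2n -addnn.
rewrite [X in (_ + X <= _)%N]exchange_big /= -big_split /=.
rewrite mul2n -addnn [X in (_ <= _ + X)%N]exchange_big /= -big_split /=.
apply: leq_sum => i _; rewrite -!big_split /=; apply: leq_sum => j _.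
have := nat_Cauchy (a i * b j) (a j * b i) => -[+ _].
by rewrite !expnMn; nia.
Qed.

Lemma leq_sum_count (T : eqType) (s t : seq T) (phi : T -> nat) :
  (forall x, count_mem x s <= count_mem x t)%N ->
  (\sum_(x <- s) phi x <= \sum_(x <- t) phi x)%N.
Proof.
move/count_subseqP => [r /subseqP[m _ ->]] st.
rewrite (perm_big _ st) /= {st s}.
elim: t m => [|y t IH] [|[] m] //=; rewrite ?big_nil ?big_cons //.
- by rewrite leq_add2l IH.
- by rewrite (leq_trans (IH m)) // leq_addl.
Qed.

Lemma sum_count_super (T : eqType) (s r : seq T) (phi : T -> nat) :
  uniq r -> {subset s <= r} ->
  (\sum_(x <- s) phi x = \sum_(z <- r) count_mem z s * phi z)%N.
Proof.
move=> ur; elim: s => [|x s IH] sr.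
  by rewrite big_nil big1.
have xr : x \in r by apply: sr; rewrite mem_head.
rewrite big_cons {}IH; last by move=> y ys; apply: sr; rewrite inE ys orbT.
under [RHS]eq_bigr => z _ do rewrite /= mulnDl.
rewrite big_split /=; congr (_ + _)%N.
rewrite (bigD1_seq x) //= eqxx mul1n big1 ?addn0 // => z zx.
by rewrite eq_sym (negbTE zx).
Qed.

Definition msub (T : eqType) (s t : seq T) :=
  all (fun x => count_mem x s <= count_mem x t)%N s.

Lemma msubP (T : eqType) (s t : seq T) :
  reflect (forall x, count_mem x s <= count_mem x t)%N (msub s t).
Proof.
apply: (iffP allP) => [st x|st x _]; last exact: st.
by case: (boolP (x \in s)) => [/st//|/count_memPn ->].
Qed.

Lemma msub_refl (T : eqType) (s : seq T) : msub s s.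
Proof. exact/msubP. Qed.

Lemma msub_perm (T : eqType) (s t : seq T) : perm_eq s t -> msub s t.
Proof. by move/permP => st; apply/msubP => x; rewrite st. Qed.

Lemma msub_map (T U : eqType) (h : T -> U) (s t : seq T) :
  msub s t -> msub (map h s) (map h t).
Proof.
move/msubP/count_subseqP => [r rt sr]; apply/msubP/count_subseqP.
by exists (map h r); [exact: map_subseq | exact: perm_map].
Qed.

Lemma msub_filter (T : eqType) (P Q : pred T) (s : seq T) :
  subpred P Q -> msub (filter P s) (filter Q s).
Proof.
move=> PQ; apply/msubP => x; rewrite !count_filter; apply: sub_count => y /=.
by move=> /andP[-> /PQ].
Qed.

Lemma msub_filterl (T : eqType) (P : pred T) (s : seq T) : msub (filter P s) s.
Proof. by rewrite -[X in msub _ X]filter_predT; exact: msub_filter. Qed.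

(** * Multiplicative energy: Cauchy-Schwarz and Hoelder *)

Section Energy.
Variable F : fieldType.
Local Notation G := (F * F)%type.
Implicit Types (s t f g h : seq G) (L M : seq (seq G)).

(* Unlike the inverse of the product ring, this is multiplicative everywhere. *)
Definition pinv (x : G) : G := (x.1^-1, x.2^-1).

Lemma pinvM x y : pinv (x * y) = pinv x * pinv y.
Proof. by rewrite /pinv /= !invfM. Qed.

Lemma pinvK : involutive pinv.
Proof. by case=> a b; rewrite /pinv /= !invrK. Qed.

Lemma pinv1 : pinv 1 = 1.
Proof. by rewrite /pinv /= !invr1. Qed.

Lemma mul_eq1_pinv (x y : G) : x * y = 1 -> x = pinv y.
Proof.
case: x y => [a b] [c d] [ac bd]; have cU : c != 0.
  by apply/eqP => c0; move: ac => /eqP; rewrite c0 mulr0 eq_sym oner_eq0.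
have dU : d != 0.
  by apply/eqP => d0; move: bd => /eqP; rewrite d0 mulr0 eq_sym oner_eq0.
by rewrite /pinv /= -[LHS]/(a, b) -(mulfK cU a) -(mulfK dU b) ac bd !mul1r.
Qed.

Definition conj s := map pinv s.

Lemma conjK : involutive conj.
Proof. by move=> s; rewrite /conj mapK //; exact: pinvK. Qed.

Fixpoint prods L : seq G :=
  if L is s :: L' then [seq x * y | x <- s, y <- prods L'] else [:: 1].

Definition nsol L : nat := \sum_(x <- prods L) (x == 1%R).

Lemma sum_prods_cons s L (phi : G -> nat) :
  (\sum_(z <- prods (s :: L)) phi z =
   \sum_(x <- s) \sum_(y <- prods L) phi (x * y)%R)%N.
Proof. by rewrite /= big_allpairs_dep. Qed.

Lemma sum_prods_cat L M (phi : G -> nat) :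
  (\sum_(z <- prods (L ++ M)) phi z =
   \sum_(x <- prods L) \sum_(y <- prods M) phi (x * y)%R)%N.
Proof.
elim: L phi => [|s L IH] phi.
  by rewrite big_seq1; apply: eq_bigr => y _; rewrite mul1r.
rewrite cat_cons !sum_prods_cons; apply: eq_bigr => x _.
rewrite IH; apply: eq_bigr => y _.
by apply: eq_bigr => z _; rewrite mulrA.
Qed.

Lemma sum_prods_perm L M (phi : G -> nat) :
  perm_eq L M ->
  (\sum_(z <- prods L) phi z = \sum_(z <- prods M) phi z)%N.
Proof.
move=> LM; pose P M := (\sum_(z <- prods L) phi z = \sum_(z <- prods M) phi z)%N.
apply: (@catCA_perm_ind _ P _ L M LM) => // L1 L2 L3; rewrite /P => ->.
rewrite !catA !(@sum_prods_cat (_ ++ _)) !sum_prods_cat exchange_big /=.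
apply: eq_bigr => x _; apply: eq_bigr => y _.
by apply: eq_bigr => z _; rewrite [y * x]mulrC.
Qed.

Lemma nsol_perm L M : perm_eq L M -> nsol L = nsol M.
Proof. exact: sum_prods_perm. Qed.

Lemma sum_prods_le L M (phi : G -> nat) :
  all2 (@msub _) L M ->
  (\sum_(z <- prods L) phi z <= \sum_(z <- prods M) phi z)%N.
Proof.
elim: L M phi => [|s L IH] [|t M] phi //= /andP[/msubP st LM].
rewrite !big_allpairs_dep.
apply: (@leq_trans (\sum_(x <- s) \sum_(y <- prods M) phi (x * y)%R)%N).
  by apply: leq_sum => x _; apply: (IH M (fun y => phi (x * y)%R)).
exact: leq_sum_count.
Qed.

Lemma nsol_le L M :
  all2 (@msub _) L M ->
  (nsol L <= nsol M)%N.
Proof. exact: sum_prods_le. Qed.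

Lemma nsol_cat s t L : nsol ((s ++ t) :: L) = (nsol (s :: L) + nsol (t :: L))%N.
Proof. by rewrite /nsol !sum_prods_cons big_cat. Qed.

Lemma prods_conj L : prods (map conj L) = conj (prods L).
Proof.
elim: L => [|s L IH] /=; first by rewrite /conj /= pinv1.
rewrite IH /conj map_allpairs allpairs_mapl allpairs_mapr.
by apply: eq_allpairs => x y; rewrite pinvM.
Qed.

(** Grouped by the value [z] of the first product, the count pairs the representation function of
    [L] at [z] with that of [M] at the inverse of [z]; their squared norms are the two counts on the
    right. *)
Lemma nsol_cauchy_schwarz L M :
  (nsol (L ++ M) ^ 2 <= nsol (L ++ map conj L) * nsol (M ++ map conj M))%N.
Proof.
rewrite /nsol !sum_prods_cat !prods_conj.
set s := prods L; set t := prods M; pose r := undup (s ++ conj t).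
(* A [z] with a zero coordinate takes part in no solution. This idempotent indicator removes it from
   both representation functions. *)
pose unit (z : G) : nat := (z * pinv z == 1)%R.
have unitE z : (unit z * unit z = unit z)%N by rewrite /unit; case: eqP.
have countP p z : count_mem z (conj p) = count_mem (pinv z) p.
  rewrite count_map; apply: eq_count => x /=.
  by apply/eqP/eqP => [<-|->]; rewrite pinvK.
have key p q : {subset p <= s ++ conj t} ->
    (\sum_(x <- p) \sum_(y <- q) (x * y == 1)%R =
     \sum_(z <- r) (unit z * count_mem z p) * (unit z * count_mem (pinv z) q))%N.
  move=> pr; rewrite (@sum_count_super _ p r) ?undup_uniq //; last first.
    by move=> x /pr; rewrite mem_undup.
  apply: eq_bigr => x _.
  rewrite [RHS](_ : _ = count_mem x p * (unit x * count_mem (pinv x) q))%N; last first.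
    by rewrite mulnACA unitE mulnCA.
  congr (_ * _)%N; rewrite -sum1_count big_distrr [RHS]big_mkcond /=.
  apply: eq_bigr => y _; rewrite muln1 /unit.
  case: (eqVneq y (pinv x)) => [->//|nyx]; case: eqP => // xy.
  by rewrite mulrC in xy; rewrite (mul_eq1_pinv xy) eqxx in nyx.
have ss : {subset s <= s ++ conj t} by move=> x xs; rewrite mem_cat xs.
have st : {subset conj t <= s ++ conj t} by move=> x xs; rewrite mem_cat xs orbT.
have -> : (\sum_(x <- t) \sum_(y <- conj t) (x * y == 1)%R =
           \sum_(x <- conj t) \sum_(y <- t) (x * y == 1)%R)%N.
  rewrite exchange_big; apply: eq_bigr => x _; apply: eq_bigr => y _.
  by rewrite mulrC.
rewrite !key //; apply: leq_trans (cauchy_schwarz_nat _ _ _) _.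
apply: eq_leq; congr (_ * _)%N; apply: eq_bigr => z _; rewrite -mulnn.
  by rewrite countP pinvK.
by rewrite countP.
Qed.

(** The multiplicative energy; working in [F * F] imposes one equation per coordinate. *)
Definition ener k f := nsol (nseq k f ++ nseq k (conj f)).

(** Here [m] of the [k] factors on each side come from [g]: these counts interpolate between the
    energies of [f] and of [g]. *)
Definition mix k m g f :=
  nsol (nseq m g ++ nseq m (conj g) ++ nseq (k - m) f ++ nseq (k - m) (conj f)).

Lemma mix0 k g f : mix k 0 g f = ener k f.
Proof. by rewrite /mix subn0. Qed.

Lemma mixk k g f : mix k k g f = ener k g.
Proof. by rewrite /mix subnn cats0. Qed.

Lemma mix_logconvex k m g f : (0 < m < k)%N ->
  (mix k m g f ^ 2 <= mix k m.-1 g f * mix k m.+1 g f)%N.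
Proof.
(* One half gets one factor of type [g] less, the other one more, so each half joined with its
   conjugate is the mixed count at a neighbouring index. *)
case: m => // m /= mk; pose L := nseq m g ++ rcons (nseq (k - m.+1) f) (conj f).
pose M := g :: nseq m.+1 (conj g) ++ nseq (k - m.+2) (conj f).
have -> : mix k m.+1 g f = nsol (L ++ M).
  apply: nsol_perm; apply/permP => p; rewrite /L /M -cats1.
  rewrite !(count_cat, count_nseq) /= !(count_cat, count_nseq) /=.
  by case: (p g); case: (p (conj g)); case: (p f); case: (p (conj f)); lia.
apply: leq_trans (nsol_cauchy_schwarz _ _) _.
apply: eq_leq; congr (_ * _)%N; apply: nsol_perm; apply/permP => p.
  rewrite /L -cats1 !(map_cat, map_nseq, count_cat, count_nseq) /= conjK.
  by case: (p g); case: (p (conj g)); case: (p f); case: (p (conj f)); lia.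
rewrite /M /= !(map_cat, map_nseq, count_cat, count_nseq) /= ?conjK.
rewrite !(map_cat, map_nseq, count_cat, count_nseq) /= ?conjK.
by case: (p g); case: (p (conj g)); case: (p f); case: (p (conj f)); lia.
Qed.

(** Log-convexity makes the ratios [a m.+1 / a m] nondecreasing, so [a k / a 0] is at least the
    [k]-th power of the first one; [ratio] says this without division. *)
Lemma logconvex_first (a : nat -> nat) k :
  (forall m, (0 < m < k)%N -> (a m ^ 2 <= a m.-1 * a m.+1)%N) ->
  (0 < k)%N -> (a 1 ^ k <= a 0 ^ k.-1 * a k)%N.
Proof.
move=> lc k0.
have ratio m : (m < k)%N -> (a 1 * a m <= a 0 * a m.+1)%N.
  elim: m => [|m IH] mk; first by rewrite mulnC.
  have := lc m.+1 mk; have := IH (ltnW mk) => /=; rewrite -mulnn.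
  case: (posnP (a m.+1)) => [-> |am1]; first by move=> _ _; rewrite muln0.
  case: (posnP (a m)) => [-> |am]; first by nia.
  move=> h1 h2; rewrite -(leq_pmul2l am) -(leq_pmul2l am1).
  have := leq_mul h1 h2; rewrite !mulnA; nia.
have : forall m, (0 < m <= k)%N -> (a 1 ^ m <= a 0 ^ m.-1 * a m)%N.
  elim=> // -[_ _|m IH mk]; first by rewrite expn1 mul1n.
  rewrite expnS (leq_trans (leq_mul (leqnn _) (IH (ltnW mk)))) //=.
  rewrite [X in (_ <= X)%N](_ : _ = a 0 ^ m * (a 0 * a m.+2))%N; last first.
    by rewrite expnSr mulnA.
  by rewrite mulnCA leq_mul2l ratio ?orbT.
by apply; rewrite k0 leqnn.
Qed.

(** Log-convexity between the end points [m = 0] and [m = k] gives the Hoelder inequality for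
    energies. *)
Lemma mix1_holder k g f : (0 < k)%N ->
  (mix k 1 g f ^ k <= ener k f ^ k.-1 * ener k g)%N.
Proof.
move=> k0; rewrite -(mix0 k g f) -(mixk k g f).
by apply: (@logconvex_first (fun m => mix k m g f)) => // m; exact: mix_logconvex.
Qed.

Lemma perm_conj_pairs f L : all (fun h => (h == f) || (h == conj f)) L ->
  perm_eq (L ++ map conj L) (nseq (size L) f ++ nseq (size L) (conj f)).
Proof.
elim: L => //= h L IH /andP[hf /IH /permP Lf]; apply/permP => p.
have := Lf p; rewrite /= !count_cat /= ?count_cat /=.
by case/orP: hf => /eqP ->; rewrite ?conjK; lia.
Qed.

(** With one of the two special factors in each half, Cauchy-Schwarz symmetrises both halves to the
    same mixed count, whichever factors are conjugated. *)
Lemma nsol_pair_le k g f h h' L : (0 < k)%N ->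
  all (fun s => (s == g) || (s == conj g)) [:: h; h'] ->
  all (fun s => (s == f) || (s == conj f)) L -> size L = (k.-1).*2 ->
  (nsol (h :: h' :: L) <= mix k 1 g f)%N.
Proof.
move=> k0 hg fL sL; pose L1 := h :: take k.-1 L; pose L2 := h' :: drop k.-1 L.
have -> : nsol (h :: h' :: L) = nsol (L1 ++ L2).
  apply: nsol_perm; rewrite /L1 /L2 /= perm_cons perm_sym.
  by rewrite -[h' :: drop _ _]cat1s perm_catCA /= cat_take_drop.
have half s M : (s == g) || (s == conj g) ->
    all (fun s => (s == f) || (s == conj f)) M -> size M = k.-1 ->
    nsol ((s :: M) ++ map conj (s :: M)) = mix k 1 g f.
  move=> sg fM sM; apply: nsol_perm; apply/permP => p.
  have /permP/(_ p) := perm_conj_pairs fM; rewrite sM subn1 /=.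
  rewrite !count_cat /=.
  by case/orP: sg => /eqP ->; rewrite ?conjK; lia.
move: hg => /=; rewrite andbT => /andP[hg h'g].
have [f1 f2] : all (fun s => (s == f) || (s == conj f)) (take k.-1 L) /\
    all (fun s => (s == f) || (s == conj f)) (drop k.-1 L).
  by apply/andP; rewrite -all_cat cat_take_drop.
rewrite -leq_sqr; apply: leq_trans (nsol_cauchy_schwarz L1 L2) _.
rewrite !half ?mulnn ?size_drop ?size_takel ?sL //; lia.
Qed.

(** Expanding one factor writes the energy as [x + y]. By Cauchy-Schwarz [x ^ 2] and [y ^ 2] are at
    most the energy times the mixed counts, and the square of [x + y] is at most
    [2 (x ^ 2 + y ^ 2)]. *)
Lemma ener_cat_le k f1 f2 : (0 < k)%N ->
  (ener k (f1 ++ f2) <=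
   2 * (mix k 1 f1 (f1 ++ f2) + mix k 1 f2 (f1 ++ f2)))%N.
Proof.
move=> k0; set f := f1 ++ f2.
pose R := nseq k.-1 f ++ nseq k (conj f).
have EE : ener k f = (nsol (f1 :: R) + nsol (f2 :: R))%N.
  by rewrite -nsol_cat /ener -{1}(prednK k0).
have half h : (nsol (h :: R) ^ 2 <= mix k 1 h f * ener k f)%N.
  have -> : h :: R = (h :: nseq k.-1 f) ++ nseq k (conj f) by [].
  apply: leq_trans (nsol_cauchy_schwarz _ _) _.
  apply: eq_leq; congr (_ * _)%N; apply: nsol_perm; apply/permP => p.
    rewrite /= !(map_cat, map_nseq, count_cat, count_nseq) /= subn1.
    by rewrite count_nseq; lia.
  by rewrite map_nseq conjK !count_cat addnC.
case: (posnP (ener k f)) => [->//|E0].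
rewrite -(leq_pmul2r E0) -mulnA mulnDl.
have := half f1; have := half f2; move: EE; set x := nsol _; set y := nsol _.
move: (ener k f) => e -> hy hx; apply: leq_trans (_ : 2 * (x ^ 2 + y ^ 2) <= _)%N.
  by have [+ _] := nat_Cauchy x y; rewrite mulnDl; nia.
by rewrite leq_mul2l /= leq_add.
Qed.

End Energy.

(** * Peeling off the factors that lie outside a subgroup *)

Section Peeling.
Variable F : fieldType.
Local Notation G := (F * F)%type.
Implicit Types (f g h : seq G) (b : bool).

(** The one factor outside the subgroup would be the inverse of a product of its members. *)
Lemma nsol_subgroup_eq0 (U : G -> Prop) g (L : seq (seq G)) :
  U 1 -> (forall x y, U x -> U y -> U (x * y)) -> (forall x, U x -> U (pinv x)) ->
  {in g, forall x, ~ U x} -> {in L, forall s, {in s, forall x, U x}} ->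
  nsol (g :: L) = 0%N.
Proof.
move=> U1 UM UV gU LU; rewrite /nsol sum_prods_cons big_seq big1 // => x xg.
have pU : {in prods L, forall y, U y}.
  elim: L LU => [|s L IH] LU y /=; first by rewrite inE => /eqP ->.
  case/allpairsP => -[c d] [cs dL ->] /=; apply: UM.
    by apply: LU cs; rewrite mem_head.
  by apply: IH dL => t tL; apply: LU; rewrite inE tL orbT.
rewrite big_seq big1 // => y yL; case: eqP => // xy; case: (gU x xg).
by rewrite (mul_eq1_pinv xy); apply/UV/pU.
Qed.

(** The boolean marks the side of the equation, so that tuples of factors become images of boolean
    lists, which allow induction. *)
Definition sconj b f := if b then f else conj f.

Lemma sconj_cat b f g : sconj b (f ++ g) = sconj b f ++ sconj b g.
Proof. by case: b => //=; rewrite /conj map_cat. Qed.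

Lemma ener_sconj k f :
  ener k f = nsol (map (sconj^~ f) (nseq k true ++ nseq k false)).
Proof. by rewrite map_cat !map_nseq. Qed.

Lemma all_sconj f bs : all (fun s => (s == f) || (s == conj f)) (map (sconj^~ f) bs).
Proof. by apply/allP => s /mapP[b _ ->]; case: b => /=; rewrite eqxx ?orbT. Qed.

Lemma msub_conj f g : msub f g -> msub (conj f) (conj g).
Proof. exact: msub_map. Qed.

Lemma all2_msub_refl (L : seq (seq G)) : all2 (@msub _) L L.
Proof. by elim: L => //= s L ->; rewrite msub_refl. Qed.

Lemma all2_msub_sconj f g bs : msub f g ->
  all2 (@msub _) (map (sconj^~ f) bs) (map (sconj^~ g) bs).
Proof.
by move=> fg; elim: bs => //= b bs ->; case: b; rewrite /= ?fg ?msub_conj.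
Qed.

Lemma all2_cat (T : Type) (r : rel T) (s1 s2 t1 t2 : seq T) :
  all2 r s1 t1 -> all2 r s2 t2 -> all2 r (s1 ++ s2) (t1 ++ t2).
Proof. by elim: s1 t1 => [|x s1 IH] [|y t1] //= /andP[-> h1] h2; exact: IH. Qed.

Lemma ener_le k f g : msub f g -> (ener k f <= ener k g)%N.
Proof. by move=> fg; rewrite !ener_sconj; apply: nsol_le; exact: all2_msub_sconj. Qed.

Lemma mix1_le k f g h : msub f g -> (mix k 1 h f <= mix k 1 h g)%N.
Proof.
move=> fg; apply: nsol_le => /=; rewrite !msub_refl /=; apply: all2_cat.
  by rewrite -(map_nseq _ (sconj^~ f) true)
       -(map_nseq _ (sconj^~ g) true) all2_msub_sconj.
by rewrite -(map_nseq _ (sconj^~ f) false)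
     -(map_nseq _ (sconj^~ g) false) all2_msub_sconj.
Qed.

(* Expand every factor as [h ++ t]: no term has exactly one factor [h], and the
   terms with at least two are counted by their first two occurrences. *)
Lemma ener_peel (U : G -> Prop) k h t : (0 < k)%N ->
  U 1 -> (forall x y, U x -> U y -> U (x * y)) -> (forall x, U x -> U (pinv x)) ->
  {in h, forall x, ~ U x} -> {in t, forall x, U x} ->
  (ener k (h ++ t) <= ener k t + 'C(2 * k, 2) * mix k 1 h (h ++ t))%N.
Proof.
move=> k0 U1 UM UV hU tU; set f := h ++ t.
have ft : msub t f by apply/msubP => x; rewrite count_cat leq_addl.
have shU b : {in sconj b h, forall x, ~ U x}.
  case: b => //= x /mapP[y yh ->] /UV; rewrite pinvK; exact: hU.
have stU b : {in sconj b t, forall x, U x}.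
  by case: b => //= x /mapP[y yh ->]; apply/UV/tU.
(* One [h] is fixed and [cs] lists the factors not yet expanded: a second [h] gives a pair, bounded
   by [nsol_pair_le], and if none appears the count vanishes. *)
have one b bs cs : (1 + size bs + size cs = 2 * k)%N ->
    (nsol (sconj b h :: map (sconj^~ t) bs ++ map (sconj^~ f) cs) <=
     size cs * mix k 1 h f)%N.
  elim: cs bs => [|c cs IH] bs sz.
    rewrite cats0 (@nsol_subgroup_eq0 U) // => s /mapP[b' _ ->]; exact: stU.
  have -> : nsol (sconj b h :: map (sconj^~ t) bs ++ map (sconj^~ f) (c :: cs)) =
      (nsol (sconj c h :: sconj b h :: map (sconj^~ t) bs ++ map (sconj^~ f) cs) +
       nsol (sconj b h :: map (sconj^~ t) (c :: bs) ++ map (sconj^~ f) cs))%N.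
    rewrite [X in (_ + X)%N](@nsol_perm _ _
      (sconj c t :: sconj b h :: map (sconj^~ t) bs ++ map (sconj^~ f) cs)).
      rewrite -nsol_cat -sconj_cat -/f; apply: nsol_perm; apply/permP => p.
      by rewrite /= !count_cat /=; lia.
    by apply/permP => p; rewrite /= !count_cat /=; lia.
  rewrite mulSn leq_add //; last by apply: IH => /=; move: sz => /=; lia.
  apply: (@leq_trans (nsol (sconj c h :: sconj b h :: map (sconj^~ f) (bs ++ cs)))).
    apply: nsol_le; rewrite /= !msub_refl map_cat all2_cat ?all2_msub_refl //.
    exact: all2_msub_sconj.
  apply: nsol_pair_le => //; last by rewrite size_map size_cat; move: sz => /=; lia.
    by rewrite /=; case: (b); case: (c); rewrite /= !eqxx ?orbT.
  exact: all_sconj.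
(* The first [h] met in [cs] is charged by [one] to the factors after it; Pascal's rule sums the
   charges to the binomial coefficient. *)
have two bs cs : (size bs + size cs = 2 * k)%N ->
    (nsol (map (sconj^~ t) bs ++ map (sconj^~ f) cs) <=
     nsol (map (sconj^~ t) (bs ++ cs)) + 'C(size cs, 2) * mix k 1 h f)%N.
  elim: cs bs => [|c cs IH] bs sz; first by rewrite !cats0 leq_addr.
  have -> : nsol (map (sconj^~ t) bs ++ map (sconj^~ f) (c :: cs)) =
      (nsol (sconj c h :: map (sconj^~ t) bs ++ map (sconj^~ f) cs) +
       nsol (map (sconj^~ t) (c :: bs) ++ map (sconj^~ f) cs))%N.
    rewrite -nsol_cat -sconj_cat -/f; apply: nsol_perm; apply/permP => p.
    by rewrite /= !count_cat /=; lia.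
  have h1 := one c bs cs; have h2 := IH (c :: bs).
  move: sz => /= sz; rewrite binS bin1 mulnDl.
  have -> : nsol (map (sconj^~ t) (bs ++ c :: cs)) =
            nsol (map (sconj^~ t) ((c :: bs) ++ cs)).
    apply: nsol_perm; apply: perm_map.
    by rewrite -[c :: cs]cat1s -[c :: bs]cat1s -catA perm_catCA.
  rewrite addnC addnA leq_add //; first by apply: h2 => /=; lia.
  by apply: h1; lia.
rewrite !ener_sconj; have := two [::] (nseq k true ++ nseq k false).
by rewrite /= size_cat !size_nseq addnn -mul2n; apply.
Qed.

(* [U j] is the subgroup of level at least [j], so the elements of a fibre of
   minimal level cannot occur exactly once in a solution. *)
Lemma ener_filtration (U : nat -> G -> Prop) (w : G -> nat) k f J : (0 < k)%N ->
  (forall j, U j 1) -> (forall j x y, U j x -> U j y -> U j (x * y)) ->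
  (forall j x, U j x -> U j (pinv x)) ->
  {in f, forall x j, U j.+1 x <-> (j < w x)%N} -> {in f, forall x, (w x < J)%N} ->
  (ener k f <=
   'C(2 * k, 2) * \sum_(j < J) mix k 1 [seq x <- f | w x == j] f)%N.
Proof.
move=> k0 U1 UM UV Uw fJ.
pose ge j := [seq x <- f | j <= w x]%N.
have step j : (ener k (ge j) <=
    ener k (ge j.+1) + 'C(2 * k, 2) * mix k 1 [seq x <- f | w x == j] f)%N.
  set h := [seq x <- f | w x == j].
  have pe : perm_eq (h ++ ge j.+1) (ge j).
    have <- : filter (fun x => w x == j) (ge j) = h.
      by rewrite -filter_predI; apply: eq_filter => x /=; case: ltngtP.
    have <- : filter (predC (fun x => w x == j)) (ge j) = ge j.+1.
      by rewrite -filter_predI; apply: eq_filter => x /=; case: ltngtP.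
    by rewrite perm_filterC.
  apply: (@leq_trans (ener k (h ++ ge j.+1))).
    by apply/ener_le/msub_perm; rewrite perm_sym.
  apply: (leq_trans (@ener_peel (U j.+1) k h (ge j.+1) k0 _ _ _ _ _)) => //.
  - exact: UM.
  - exact: UV.
  - by move=> x; rewrite mem_filter => /andP[/eqP wx xf] /(Uw x xf); rewrite wx ltnn.
  - by move=> x; rewrite mem_filter => /andP[wx xf]; apply/(Uw x xf).
  rewrite leq_add2l leq_mul2l; apply/orP; right; apply: mix1_le.
  apply/msubP => x; rewrite (permP pe); apply/msubP; exact: msub_filterl.
have tele n : (ener k (ge 0%N) <= ener k (ge n) +
    'C(2 * k, 2) * \sum_(j < n) mix k 1 [seq x <- f | w x == j] f)%N.
  elim: n => [|n IH]; first by rewrite big_ord0 muln0 addn0.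
  rewrite big_ord_recr /= mulnDr [X in (_ <= _ + X)%N]addnC addnA.
  by apply: leq_trans IH _; rewrite leq_add2r; exact: step.
have := tele J; have -> : ge 0%N = f by apply/all_filterP/allP.
have -> : ge J = [::].
  apply/eqP; rewrite -(negbK (_ == _)) -has_filter; apply/hasPn => x /fJ.
  by rewrite ltnNge.
suff -> : @ener F k [::] = 0%N by rewrite add0n.
by case: (k) k0 => // k' _; rewrite /ener /nsol /= big_nil.
Qed.

End Peeling.

(** * Recombining pieces, with [k]-th roots cleared *)

Lemma exp_ratio_add k E a b n m : (a ^ k <= E * n ^ k -> b ^ k <= E * m ^ k ->
  0 < k -> (a + b) ^ k <= E * (n + m) ^ k)%N.
Proof.
(* Bounds of the form [a <= E^(1/k) n] are added: the summand with the larger ratio controls the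
   sum, as [(a' + b') m' <= b' (n' + m')]. *)
have half a' b' n' m' : (b' ^ k <= E * m' ^ k -> 0 < m' -> 0 < k ->
    a' * m' <= b' * n' -> (a' + b') ^ k <= E * (n' + m') ^ k)%N.
  move=> hb m0 k0 r.
  rewrite -(@leq_pmul2r (m' ^ k)) ?expn_gt0 ?m0 // -expnMn.
  apply: (@leq_trans ((b' * (n' + m')) ^ k)%N); first by rewrite leq_exp2r //; lia.
  by rewrite expnMn -mulnA [((_ + _) ^ _ * _)%N]mulnC mulnA leq_mul2r hb orbT.
move=> ha hb k0; case: (posnP m) => [m0|m0].
  move: hb; rewrite m0 exp0n // muln0 leqn0 expn_eq0 => /andP[/eqP -> _].
  by rewrite !addn0.
case: (posnP n) => [n0|n0].
  move: ha; rewrite n0 exp0n // muln0 leqn0 expn_eq0 => /andP[/eqP -> _].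
  by rewrite !add0n.
case: (leqP (a * m) (b * n)) => r; first exact: half.
by rewrite addnC [(n + m)%N]addnC; apply: half => //; exact: ltnW.
Qed.

Lemma exp_ratio_sum k E (I : Type) (r : seq I) (a n : I -> nat) : (0 < k)%N ->
  (forall i, a i ^ k <= E * n i ^ k)%N ->
  ((\sum_(i <- r) a i) ^ k <= E * (\sum_(i <- r) n i) ^ k)%N.
Proof.
move=> k0 h; elim: r => [|i r IH]; first by rewrite !big_nil exp0n.
by rewrite !big_cons; apply: exp_ratio_add.
Qed.

(** By [mix1_holder] each mixed count is at most [E^(1 - 1/k)] times [c * size (g i)], where [E] is
    the energy of [f]; summing and cancelling the power of [E] leaves the bound. *)
Lemma ener_from_pieces (F : fieldType) k B c (f : seq (F * F))
    (I : Type) (r : seq I) (g : I -> seq (F * F)) : (0 < k)%N ->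
  (ener k f <= B * \sum_(i <- r) mix k 1 (g i) f)%N ->
  (forall i, ener k (g i) <= (c * size (g i)) ^ k)%N ->
  (ener k f <= (B * c * \sum_(i <- r) size (g i)) ^ k)%N.
Proof.
move=> k0 hE hg; case: (posnP (ener k f)) => [->//|E0].
have : ((\sum_(i <- r) mix k 1 (g i) f) ^ k <=
    ener k f ^ k.-1 * (\sum_(i <- r) c * size (g i)) ^ k)%N.
  apply: exp_ratio_sum => // i; apply: leq_trans (mix1_holder _ _ k0) _.
  by rewrite leq_mul2l hg orbT.
rewrite -big_distrr /= => h.
rewrite -(@leq_pmul2l (ener k f ^ k.-1)) ?expn_gt0 ?E0 // -expnSr prednK //.
apply: (@leq_trans ((B * \sum_(i <- r) mix k 1 (g i) f) ^ k)%N).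
  by rewrite leq_exp2r.
rewrite expnMn -[(B * c * _)%N]mulnA [((B * _) ^ k)%N]expnMn.
by rewrite mulnCA leq_mul2l h orbT.
Qed.

Lemma size_prods (F : fieldType) (f : seq (F * F)) (L : seq (seq (F * F))) :
  all (fun s => size s == size f) L -> size (prods L) = (size f ^ size L)%N.
Proof.
elim: L => //= s L IH /andP[/eqP sf /IH Lf].
by rewrite size_allpairs sf Lf expnS.
Qed.

Lemma ener_trivial (F : fieldType) k (f : seq (F * F)) :
  (ener k f <= size f ^ (2 * k))%N.
Proof.
rewrite ener_sconj /nsol; set L := map _ _.
have -> : (size f ^ (2 * k) = size (prods L))%N.
  rewrite (@size_prods _ f).
    by rewrite /L size_map size_cat !size_nseq addnn -mul2n.
  by apply/allP => s /mapP[b _ ->]; case: b; rewrite /= ?size_map.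
by rewrite -sum1_size; apply: leq_sum => x _; case: eqP.
Qed.

(** * Valuations and congruences of rationals *)

Definition vq (p : nat) (x : rat) : int :=
  (logn p `|numq x|)%:Z - (logn p `|denq x|)%:Z.

Lemma vq_frac p (n m : int) : n != 0 -> m != 0 ->
  vq p (n%:~R / m%:~R) = (logn p `|n|)%:Z - (logn p `|m|)%:Z.
Proof.
move=> n0 m0; set x := n%:~R / m%:~R.
have x0 : numq x != 0 by rewrite numq_eq0 mulf_neq0 ?invr_eq0 ?intr_eq0.
have /(congr1 absz) : numq x * m = n * denq x.
  have /eqP := divq_num_den x; rewrite {3}/x eqr_div ?intr_eq0 ?denq_neq0 //.
  by rewrite -!intrM => /eqP/intr_inj.
rewrite !abszM => /(congr1 (logn p)).
by rewrite !lognM ?absz_gt0 ?denq_neq0 // /vq => h; lia.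
Qed.

Lemma vqM p x y : x != 0 -> y != 0 -> vq p (x * y) = vq p x + vq p y.
Proof.
move=> x0 y0; rewrite -{1}(divq_num_den x) -{1}(divq_num_den y) mulf_div -!intrM.
rewrite vq_frac ?mulf_neq0 ?numq_eq0 ?denq_neq0 // !abszM.
by rewrite !lognM ?absz_gt0 ?numq_eq0 ?denq_neq0 // /vq; lia.
Qed.

Lemma vqN p x : vq p (- x) = vq p x.
Proof. by rewrite /vq numqN denqN abszN. Qed.

Lemma vqV p x : x != 0 -> vq p x^-1 = - vq p x.
Proof.
move=> x0; rewrite -{1}(divq_num_den x) invf_div vq_frac ?numq_eq0 ?denq_neq0 //.
by rewrite /vq opprB.
Qed.

Lemma vq_norm p x : vq p `|x| = vq p x.
Proof. by case: (lerP 0 x) => [/ger0_norm|/ltr0_norm] ->; rewrite ?vqN. Qed.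

Lemma vq_nonprime p x : ~~ prime p -> vq p x = 0.
Proof.
move=> /negbTE pp; have lp m : logn p m = 0%N by rewrite lognE pp.
by rewrite /vq !lp subrr.
Qed.

(* The requirement on [n] only matters for [j = 0]. *)
Definition cong1 (p j : nat) (y : rat) : Prop := exists n m : int,
  [/\ ~~ (p %| `|n|)%N, ~~ (p %| `|m|)%N, (p ^ j %| `|n - m|)%N &
      y = n%:~R / m%:~R].

Lemma dvdn_absz (d : nat) (a : int) : (d %| `|a|)%N = (d%:Z %| a)%Z.
Proof. by rewrite dvdzE. Qed.

Lemma cong1_1 p j : prime p -> cong1 p j 1.
Proof.
move=> pp; exists 1, 1; split; rewrite ?subrr ?dvdn0 ?divr1 //;
  by rewrite dvdn1 neq_ltn prime_gt1 ?orbT.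
Qed.

Lemma cong1M p j x y : prime p -> cong1 p j x -> cong1 p j y -> cong1 p j (x * y).
Proof.
move=> pp [n [m [pn pm d ->]]] [n' [m' [pn' pm' d' ->]]].
exists (n * n'), (m * m'); split; rewrite ?abszM ?Euclid_dvdM ?negb_or ?pn ?pm //.
  have -> : n * n' - m * m' = (n - m) * n' + m * (n' - m').
    by rewrite mulrBl mulrBr addrA subrK.
  rewrite !dvdn_absz in d d' *.
  by apply: rpredD; [exact: dvdz_mulr | exact: dvdz_mull].
by rewrite !intrM mulf_div.
Qed.

Lemma cong1V p j x : cong1 p j x -> cong1 p j x^-1.
Proof.
move=> [n [m [pn pm d ->]]]; exists m, n; split => //; last by rewrite invf_div.
by rewrite -abszN opprB.
Qed.

(** From [1 + x = n / m] one gets [x = (n - m) / m] with [m] prime to [p]. Conversely the reduced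
    denominator of [x] serves as [m]: it is prime to [p] because the valuation is nonnegative. *)
Lemma cong1_shift p j x : prime p -> x != 0 -> 0 <= vq p x ->
  cong1 p j.+1 (1 + x) <-> (j < `|vq p x|)%N.
Proof.
move=> pp x0 vx; split.
  move=> [n [m [pn pm d e]]].
  have m0 : m != 0 by apply: contraNneq pm => ->; rewrite dvdn0.
  have ex : x = (n - m)%:~R / m%:~R.
    by rewrite intrB mulrBl divff ?intr_eq0 // -e addrC addKr.
  have nm0 : n - m != 0.
    by apply: contraNneq x0; rewrite ex => ->; rewrite mul0r.
  rewrite ex vq_frac // (_ : logn p `|m| = 0%N); last first.
    by apply/eqP; rewrite -leqn0 leqNgt logn_gt0 mem_primes (negbTE pm) !andbF.
  by rewrite subr0 absz_nat -pfactor_dvdn // absz_gt0.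
have n0 : numq x != 0 by rewrite numq_eq0.
have pden : ~~ (p %| `|denq x|)%N.
  apply/negP => pd; move: vx; rewrite /vq.
  have : (0 < logn p `|denq x|)%N.
    by rewrite logn_gt0 mem_primes pp absz_gt0 denq_neq0.
  have : logn p `|numq x| = 0%N.
    apply/eqP; rewrite -leqn0 leqNgt logn_gt0 mem_primes; apply/negP.
    move=> /and3P[_ _ pn]; have := coprime_num_den x.
    move=> /eqP g1; have : (p %| gcdn `|numq x| `|denq x|)%N by rewrite dvdn_gcd pn.
    by rewrite g1 dvdn1 => /eqP p1; move: pp; rewrite p1.
  by lia.
have -> : vq p x = (logn p `|numq x|)%:Z.
  rewrite /vq (_ : logn p `|denq x| = 0%N) ?subr0 //.
  by apply/eqP; rewrite -leqn0 leqNgt logn_gt0 mem_primes (negbTE pden) !andbF.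
rewrite absz_nat -pfactor_dvdn ?absz_gt0 // => d.
exists (denq x + numq x), (denq x); split => //.
- apply: contra pden => h.
  have pn : (p %| `|numq x|)%N by apply: dvdn_trans d; rewrite expnS dvdn_mulr.
  rewrite !dvdn_absz in h pn *.
  by have := rpredB h pn; rewrite addrK.
- by rewrite addrC addKr.
- by rewrite intrD mulrDl divff ?intr_eq0 ?denq_neq0 // divq_num_den.
Qed.

(** * Splitting the energy along one prime *)

Lemma sum_size_fibres (T : Type) (A : seq T) (w : T -> nat) J :
  (\sum_(j < J) size [seq x <- A | w x == j] <= size A)%N.
Proof.
elim: A => [|x A IH] /=; first by rewrite big1.
have -> : (\sum_(j < J) size (if w x == j then x :: [seq x <- A | w x == j]
     else [seq x <- A | w x == j]) = \sum_(j < J) (w x == j) +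
     \sum_(j < J) size [seq x <- A | w x == j])%N.
  by rewrite -big_split; apply: eq_bigr => j _; case: eqP.
rewrite -addn1 addnC leq_add //.
case: (ltnP (w x) J) => wJ.
  rewrite (bigD1 (Ordinal wJ)) //= eqxx big1 // => j.
  by rewrite -val_eqE /= eq_sym => /negbTE ->.
by rewrite big1 // => j _; case: eqP => // e; move: (ltn_ord j); rewrite -e ltnNge wJ.
Qed.

(** An equation between products of these pairs equates both the products of the elements and those
    of their shifts by [1]. *)
Definition lift2 (x : rat) : rat * rat := (x, 1 + x).

Lemma ener_signed_prime p k c (s : bool) (A : seq rat) : prime p -> (0 < k)%N ->
  {in A, forall x, x != 0 /\ (0 <= vq p x) = s} ->
  (forall z, ener k (map lift2 [seq x <- A | vq p x == z]) <=
     (c * size [seq x <- A | vq p x == z]) ^ k)%N ->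
  (ener k (map lift2 A) <= ('C(2 * k, 2) * c * size A) ^ k)%N.
Proof.
move=> pp k0 As fib.
(* For negative valuations the quotient is [1 + 1 / x], which differs from [1] by an element of
   positive valuation; as a quotient of coordinates it is multiplicative in the pair. *)
pose U j (y : rat * rat) := cong1 p j (if s then y.2 else y.2 / y.1).
pose w (y : rat * rat) := `|vq p y.1|%N.
pose J := (\max_(y <- map lift2 A) w y).+1.
have wJ : {in map lift2 A, forall y, (w y < J)%N}.
  by move=> y yA; rewrite ltnS; apply: leq_bigmax_seq.
have fibE j : [seq y <- map lift2 A | w y == j] =
    map lift2 [seq x <- A | vq p x == if s then j%:Z else - j%:Z].
  rewrite filter_map; congr map; apply: eq_in_filter => x /As[_].
  rewrite /w /=; case: (s) => h.
    by move: (vq p x) h => z h; apply/eqP/eqP; lia.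
  by move: (vq p x) h => z h; apply/eqP/eqP; lia.
apply: leq_trans (ener_from_pieces (B := 'C(2 * k, 2)) (c := c)
  (r := index_enum 'I_J) (g := fun j : 'I_J => [seq y <- map lift2 A | w y == j])
  k0 _ _) _.
- apply: (@ener_filtration _ U) => //.
  + by move=> j; rewrite /U /= divr1; case: (s); exact: cong1_1.
  + move=> j x y; rewrite /U /=; case: (s); first exact: cong1M.
    by rewrite -mulf_div; exact: cong1M.
  + move=> j x; rewrite /U /=; case: (s); first exact: cong1V.
    by rewrite -invfM; exact: cong1V.
  + move=> y /mapP[x xA ->] j; have [x0 hs] := As x xA.
    rewrite /U /w /=; case: (s) hs => hs; first exact: cong1_shift.
    have -> : (1 + x) / x = 1 + x^-1 by rewrite mulrDl divff // mul1r addrC.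
    rewrite -abszN -vqV //; apply: cong1_shift; rewrite ?invr_eq0 // vqV //.
    by move/negbT: hs; rewrite -ltNge oppr_ge0 => /ltW.
- by move=> j; rewrite fibE size_map.
- rewrite leq_exp2r // leq_mul2l; apply/orP; right.
  by apply: leq_trans (sum_size_fibres _ _ _) _; rewrite size_map.
Qed.

(** Splitting by sign first costs the factor [2] of [ener_cat_le]. *)
Lemma ener_prime p k c (A : seq rat) : prime p -> (0 < k)%N ->
  {in A, forall x, x != 0} ->
  (forall z, ener k (map lift2 [seq x <- A | vq p x == z]) <=
     (c * size [seq x <- A | vq p x == z]) ^ k)%N ->
  (ener k (map lift2 A) <= (2 * 'C(2 * k, 2) * c * size A) ^ k)%N.
Proof.
move=> pp k0 A0 fib; pose part s := [seq x <- A | (0 <= vq p x) == s].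
have pA : perm_eq (part true ++ part false) A.
  have /permPl := perm_filterC (fun x => 0 <= vq p x) A.
  have -> : part true = [seq x <- A | 0 <= vq p x].
    by apply: eq_filter => x; rewrite eqb_id.
  have -> // : part false = [seq x <- A | predC (fun x => 0 <= vq p x) x].
  by apply: eq_filter => x; rewrite eqbF_neg.
have hp s : (ener k (map lift2 (part s)) <=
             ('C(2 * k, 2) * c * size (part s)) ^ k)%N.
  apply: (@ener_signed_prime p k c s) => //.
    by move=> x; rewrite mem_filter => /andP[/eqP -> /A0].
  move=> z; rewrite /part -filter_predI.
  (* A fibre of a sign class is a full fibre of [A] or empty. *)
  case: (boolP ((0 <= z) == s)) => zs.
    have -> : [seq x <- A | predI (fun x => vq p x == z)
       (fun x => (0 <= vq p x) == s) x] = [seq x <- A | vq p x == z].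
      by apply: eq_filter => x /=; case: eqP => // ->.
    exact: fib.
  have -> : [seq x <- A | predI (fun x => vq p x == z)
       (fun x => (0 <= vq p x) == s) x] = [::].
    rewrite -(filter_pred0 A); apply: eq_filter => x /=.
    by case: eqP => // ->; exact: negbTE.
  by apply: leq_trans (ener_trivial _ _) _; rewrite exp0n // muln_gt0.
apply: (@leq_trans (ener k (map lift2 (part true ++ part false)))).
  by apply/ener_le/msub_map/msub_perm; rewrite perm_sym.
apply: leq_trans (ener_from_pieces (B := 2) (c := 'C(2 * k, 2) * c)
  (r := [:: true; false]) (g := fun s => map lift2 (part s)) k0 _ _) _.
- by rewrite big_cons big_seq1 map_cat; exact: ener_cat_le.
- by move=> s; rewrite size_map.
- rewrite big_cons big_seq1 !size_map -size_cat (perm_size pA).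
  by rewrite mulnA.
Qed.

(** At most two such elements exist, [a] and [- a], so the trivial bound on the energy suffices. *)
Lemma ener_same_norm k (A : seq rat) : (0 < k)%N -> uniq A ->
  {in A &, forall x y, `|x| = `|y|} ->
  (ener k (map lift2 A) <= (2 * size A) ^ k)%N.
Proof.
move=> k0 uA same; have sA : (size A <= 2)%N.
  case: A uA same => // a A uA same.
  rewrite -[2%N]/(size [:: a; - a]); apply: uniq_leq_size => // x xA.
  have /eqP := same x a xA (mem_head _ _).
  by rewrite eqr_norm2 !inE.
apply: leq_trans (ener_trivial _ _) _.
by rewrite size_map expnM leq_exp2r // -mulnn leq_mul.
Qed.

(** * Induction on the affine dimension of the valuation vectors *)

Section Dimension.
Variable n : nat.

(** Coordinates at non-prime indices vanish; rational entries place the valuations in a vector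
    space. *)
Definition vvec (x : rat) : 'rV[rat]_n := \row_(i < n) (vq i x)%:~R.

Lemma vvecM x y : x != 0 -> y != 0 -> vvec (x * y) = vvec x + vvec y.
Proof. by move=> x0 y0; apply/rowP => i; rewrite !mxE vqM // intrD. Qed.

Lemma vvec_norm x : vvec `|x| = vvec x.
Proof. by apply/rowP => i; rewrite !mxE vq_norm. Qed.

Definition coord_fun (i : 'I_n) : 'Hom('rV[rat]_n, 'rV[rat]_1) :=
  linfun (col i).

Lemma ener_dim k d (A : seq rat) (U : {vspace 'rV[rat]_n}) : (0 < k)%N ->
  uniq A -> {in A, forall x, x != 0} ->
  {in A &, forall x y, vvec x = vvec y -> `|x| = `|y|} ->
  {in A &, forall x y, vvec x - vvec y \in U} -> (\dim U <= d)%N ->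
  (ener k (map lift2 A) <= (2 * (2 * 'C(2 * k, 2)) ^ d * size A) ^ k)%N.
Proof.
move=> k0; elim: d A U => [|d IH] A U uA A0 sep AU dU.
  rewrite expn0 muln1; apply: ener_same_norm => // x y xA yA; apply: sep => //.
  move: dU; rewrite leqn0 dimv_eq0 => /eqP U0; apply/eqP.
  by have := AU x y xA yA; rewrite U0 memv0 subr_eq0.
case: (boolP (all (fun x => all (fun y => vvec x == vvec y) A) A)) => [|].
  move=> /allP same; apply: (@leq_trans ((2 * size A) ^ k)).
    apply: ener_same_norm => // x y xA yA; apply: sep => //.
    by apply/eqP; exact: (allP (same x xA)).
  rewrite leq_exp2r // leq_mul2r leq_pmulr ?orbT // expn_gt0 muln_gt0 bin_gt0.
  by rewrite orbC /=; lia.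
move=> /allPn[x xA /allPn[y yA]] xy.
have [i vi] : exists i : 'I_n, vq i x != vq i y.
  apply/existsP; apply: contraNT xy; rewrite negb_exists => /forallP h.
  by apply/eqP/rowP => i; rewrite !mxE; have /negPn/eqP -> := h i.
have pp : prime i by apply: contraNT vi => /vq_nonprime h; rewrite !h.
(* Differences within a fibre of [vq i] lie in [W], which is strictly smaller than [U] because it
   misses [vvec x - vvec y]. *)
pose W := (U :&: lker (coord_fun i))%VS.
have dW : (\dim W <= d)%N.
  rewrite -ltnS; apply: leq_trans dU.
  have [le eqW] := dimv_leqif_sup (capvSl U (lker (coord_fun i))).
  rewrite ltn_neqAle le andbT eqW; apply/negP => /subvP/(_ _ (AU x y xA yA)).
  rewrite memv_cap memv_ker lfunE /= => /andP[_ /eqP/matrixP/(_ ord0 ord0)].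
  rewrite !mxE => /eqP; rewrite subr_eq0 eqr_int; exact/negP.
rewrite expnS mulnCA; apply: (ener_prime pp) => // z.
apply: (IH _ W) => //.
- exact: filter_uniq.
- by move=> a; rewrite mem_filter => /andP[_ /A0].
- by move=> a b; rewrite !mem_filter => /andP[_ aA] /andP[_ bA]; exact: sep.
move=> a b; rewrite !mem_filter => /andP[/eqP az aA] /andP[/eqP bz bA].
rewrite memv_cap AU //= memv_ker lfunE /=; apply/eqP/matrixP => r j.
by rewrite !mxE az bz subrr.
Qed.

End Dimension.

(** * Product sets: Petridis' lemma and Pluennecke's inequality *)

Local Open Scope fset_scope.
Local Open Scope ring_scope.

Section ProductSets.
Variable F : fieldType.
Implicit Types (A B C X Y : {fset F}) (c : F).

Definition fprod A B : {fset F} := [fset x * y | x in A, y in B].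

Lemma fprodP A B z :
  reflect (exists x y, [/\ x \in A, y \in B & z = x * y]) (z \in fprod A B).
Proof.
apply: (iffP (imfset2P _ _ _ _ _)) => [[x /= xA [y /= yB ->]]|[x [y [xA yB ->]]]].
  by exists x, y.
by exists x => //; exists y.
Qed.

Lemma mem_fprod A B x y : x \in A -> y \in B -> x * y \in fprod A B.
Proof. by move=> xA yB; apply/fprodP; exists x, y. Qed.

Lemma fprodS A B A' B' : A `<=` A' -> B `<=` B' -> fprod A B `<=` fprod A' B'.
Proof.
move=> /fsubsetP AA' /fsubsetP BB'; apply/fsubsetP => _ /fprodP[x [y [xA yB ->]]].
by apply: mem_fprod; [exact: AA' | exact: BB'].
Qed.

Lemma fprodC A B : fprod A B = fprod B A.
Proof.
by apply/fsetP => z; apply/fprodP/fprodP => -[x [y [xA yB ->]]];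
   exists y, x; rewrite mulrC.
Qed.

Lemma fprodA A B C : fprod A (fprod B C) = fprod (fprod A B) C.
Proof.
apply/fsetP => z; apply/fprodP/fprodP => -[x [y []]].
  move=> xA /fprodP[b [c [bB cC ->]]] ->.
  by exists (x * b), c; rewrite mem_fprod // mulrA.
move=> /fprodP[a [b [aA bB ->]]] yC ->.
by exists a, (b * y); rewrite mem_fprod // mulrA.
Qed.

Lemma fprod_fsetU A B C : fprod (A `|` B) C = fprod A C `|` fprod B C.
Proof.
apply/fsetP => z; rewrite in_fsetU; apply/fprodP/orP => [[x [y []]]|].
  by rewrite in_fsetU => /orP[xA|xB] yC ->; [left | right]; exact: mem_fprod.
by case=> /fprodP[x [y [xA yC ->]]]; exists x, y; rewrite in_fsetU xA ?orbT.
Qed.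

Lemma card_fprod1 c A : c != 0 -> #|` fprod [fset c] A| = #|` A|.
Proof.
move=> c0; have -> : fprod [fset c] A = [fset c * x | x in A].
  apply/fsetP => z; apply/fprodP/imfsetP => [[x [y [/fset1P -> yA ->]]]|].
    by exists y.
  by move=> [y /= yA ->]; exists c, y; rewrite fset11.
by rewrite card_imfset //; exact: mulfI.
Qed.

Lemma leq_card_fprod c A B : c != 0 -> c \in A -> (#|` B| <= #|` fprod A B|)%N.
Proof.
move=> c0 cA; rewrite -(card_fprod1 B c0); apply/fsubset_leq_card/fprodS => //.
by rewrite fsub1set.
Qed.

(* Petridis' lemma: [X] minimises the ratio [#|XA| / #|X|] among its subsets. *)
Lemma petridis A X C :
  (forall Y, Y `<=` X ->
     #|` fprod X A| * #|` Y| <= #|` fprod Y A| * #|` X|)%N ->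
  {in C, forall c, c != 0} ->
  (#|` fprod (fprod C X) A| * #|` X| <= #|` fprod X A| * #|` fprod C X|)%N.
Proof.
move=> minX; have [m] := ubnP #|` C|; elim: m C => // m IH C.
have [->|/fset0Pn[c cC]] := eqVneq C fset0 => Cm C0.
  have e0 B : fprod fset0 B = fset0.
    by apply/fsetP => z; rewrite inE; apply/fprodP => -[x [y []]]; rewrite inE.
  by rewrite !e0 cardfs0.
set C' := C `\ c; have c0 := C0 c cC.
have {}IH : (#|` fprod (fprod C' X) A| * #|` X| <=
             #|` fprod X A| * #|` fprod C' X|)%N.
  apply: IH => [|d /fsetD1P[_ /C0]//].
  by move: Cm; rewrite (cardfsD1 c) cC.
have CE : C = [fset c] `|` C' by rewrite fsetD1K.
(* [Y] collects the [x] for which adjoining [c * x] contributes nothing new after multiplication by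
   [A]. *)
pose Y := [fset x in X | fprod [fset c * x] A `<=` fprod (fprod C' X) A].
have YE x : x \in Y =
    (x \in X) && (fprod [fset c * x] A `<=` fprod (fprod C' X) A).
  by rewrite !inE.
have YX : Y `<=` X by apply/fsubsetP => x; rewrite YE => /andP[].
(* The part [c Y A] is already present, so at most [|X A| - |Y A|] products are added. *)
have up : (#|` fprod (fprod C X) A| + #|` fprod Y A| <=
           #|` fprod (fprod C' X) A| + #|` fprod X A|)%N.
  pose cXA := fprod [fset c] (fprod X A); pose cYA := fprod [fset c] (fprod Y A).
  have sub : cYA `<=` cXA by apply: fprodS => //; exact: fprodS.
  have := fsubset_leq_card sub; have := cardfsDS sub.
  rewrite !card_fprod1 //.
  have : (#|` fprod (fprod C X) A| <=
          #|` fprod (fprod C' X) A| + #|` cXA `\` cYA|)%N.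
    apply: leq_trans (_ : #|` fprod (fprod C' X) A `|` (cXA `\` cYA)| <= _)%N;
      last by rewrite cardfsU leq_subr.
    apply/fsubset_leq_card/fsubsetP => z.
    rewrite {1}CE !fprod_fsetU -fprodA -/cXA inE => /orP[zc|zC']; last first.
      by rewrite inE zC'.
    rewrite inE in_fsetD zc andbT orbC; case: (boolP (z \in cYA)) => //=.
    case/fprodP=> _ [w [/fset1P -> /fprodP[x [y [xY yA ->]]] ->]].
    move: xY; rewrite YE => /andP[_ /fsubsetP]; apply.
    by rewrite mulrA; apply: mem_fprod => //; exact: fset11.
  by lia.
(* If [c * x] lay in [C' X], then [x] would be in [Y]; so the [c * x] with [x] outside [Y] are all
   new. *)
have dn : (#|` fprod C' X| + #|` X| <= #|` fprod C X| + #|` Y|)%N.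
  pose cXY := fprod [fset c] (X `\` Y).
  have dis : fprod C' X `&` cXY = fset0.
    apply/fsetP => z; rewrite inE in_fset0; apply/negP => /andP[zC'].
    case/fprodP => _ [x [/fset1P -> /fsetDP[xX]]].
    rewrite YE xX /= => /negP xY ez; apply: xY; rewrite -ez.
    by apply: fprodS => //; rewrite fsub1set.
  have : (#|` fprod C' X `|` cXY| <= #|` fprod C X|)%N.
    apply: fsubset_leq_card; rewrite [X in _ `<=` fprod X _]CE fprod_fsetU fsetUC.
    by apply: fsetSU; apply: fprodS => //; exact: fsubsetDl.
  rewrite cardfsU dis cardfs0 subn0 card_fprod1 // cardfsDS //.
  by have := fsubset_leq_card YX; lia.
by have := minX Y YX; nia.
Qed.

(** Descent on the cardinality: a subset violating minimality is nonempty, proper and of smaller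
    ratio, so it can replace [X]. *)
Lemma exists_min_ratio A X : X != fset0 ->
  exists Z, [/\ Z `<=` X, Z != fset0,
    forall Y, Y `<=` Z -> (#|` fprod Z A| * #|` Y| <= #|` fprod Y A| * #|` Z|)%N &
    (#|` fprod Z A| * #|` X| <= #|` fprod X A| * #|` Z|)%N].
Proof.
have [m] := ubnP #|` X|; elim: m X => // m IH X Xm X0.
pose ok (Y : fpowerset X) :=
  (#|` fprod X A| * #|` val Y| <= #|` fprod (val Y) A| * #|` X|)%N.
case: (boolP [forall Y, ok Y]) => [/forallP okX|].
  exists X; split => // Y YX.
  have YP : Y \in fpowerset X by rewrite fpowersetE.
  exact: okX [` YP].
rewrite negb_forall => /existsP[[Y /= YP]]; rewrite /ok /= -ltnNge => bad.
have YX : Y `<=` X by rewrite -fpowersetE.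
have Y0 : Y != fset0 by apply: contraTneq bad => ->; rewrite cardfs0 muln0.
have lt : (#|` Y| < #|` X|)%N.
  rewrite ltn_neqAle fsubset_leq_card // andbT; apply: contraTneq bad => e.
  suff -> : Y = X by rewrite ltnn.
  by apply/eqP; rewrite eqEfcard YX e leqnn.
have [Z [ZY Z0 Zmin ZA]] := IH Y (leq_trans lt Xm) Y0.
exists Z; split => //; first exact: fsubset_trans YX.
have Yp : (0 < #|` Y|)%N by rewrite cardfs_gt0.
rewrite -(leq_pmul2r Yp) mulnAC (leq_trans (leq_mul ZA (leqnn _))) //.
by rewrite mulnAC [X in (_ <= X)%N]mulnAC leq_mul2r (ltnW bad) orbT.
Qed.

Fixpoint fpow A k : {fset F} := if k is k'.+1 then fprod (fpow A k') A else [fset 1].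

Lemma fpow_neq0 A k : {in A, forall x, x != 0} -> {in fpow A k, forall x, x != 0}.
Proof.
move=> A0; elim: k => [|k IH] x /=; first by move/fset1P ->; exact: oner_neq0.
by case/fprodP=> a [b [/IH a0 /A0 b0 ->]]; rewrite mulf_neq0.
Qed.

(** For a ratio-minimising [X] inside [A], Petridis' lemma shows that each further factor [A]
    multiplies [|A^m X|] by at most [|A A| / |A|]. Finally [|A^k| <= |A^k X|] and [|X| <= |A|]. *)
Lemma plunnecke A k : A != fset0 -> {in A, forall x, x != 0} ->
  (#|` fpow A k| * #|` A| ^ k <= #|` fprod A A| ^ k * #|` A|)%N.
Proof.
move=> An A0; have [X [XA X0 minX rX]] := exists_min_ratio A An.
have Xp : (0 < #|` X|)%N by rewrite cardfs_gt0.
have main m : (#|` fprod (fpow A m) X| * #|` A| ^ m <=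
               #|` fprod A A| ^ m * #|` X|)%N.
  elim: m => [|m IH] /=; first by rewrite card_fprod1 ?oner_neq0 // muln1 mul1n.
  have := petridis minX (fpow_neq0 (k := m) A0).
  have -> : fprod (fprod (fpow A m) A) X = fprod (fprod (fpow A m) X) A.
    by rewrite -!fprodA [fprod A X]fprodC.
  move=> P; rewrite !expnS.
  have {}P : (#|` fprod (fprod (fpow A m) X) A| * #|` A| <=
              #|` fprod A A| * #|` fprod (fpow A m) X|)%N.
    by rewrite -(leq_pmul2r Xp); move: rX P; nia.
  rewrite mulnA; apply: leq_trans (leq_mul P (leqnn _)) _.
  by rewrite -!mulnA leq_mul2l IH orbT.
have /fset0Pn[x xX] := X0.
have x0 : x != 0 by apply: A0; move: x xX; apply/fsubsetP.
apply: leq_trans (_ : #|` fprod (fpow A k) X| * #|` A| ^ k <= _)%N.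
  by rewrite leq_mul2r [fprod (fpow _ _) X]fprodC (leq_card_fprod _ x0) ?orbT.
by apply: leq_trans (main k) _; rewrite leq_mul2l fsubset_leq_card ?orbT.
Qed.

End ProductSets.

(** * Freiman's lemma for the valuation vectors *)

Lemma exists_max_norm (s : seq rat) : s != [::] ->
  exists2 a, a \in s & {in s, forall x, `|x| <= `|a|}.
Proof.
elim: s => // x [|y s] IH _.
  by exists x; rewrite ?mem_head // => z; rewrite inE => /eqP ->.
have [a aS amax] := IH isT; case: (lerP `|x| `|a|) => xa.
  exists a; first by rewrite inE aS orbT.
  by move=> z; rewrite inE => /orP[/eqP ->//|/amax].
exists x; first exact: mem_head.
by move=> z; rewrite inE => /orP[/eqP ->//|/amax/le_trans]; apply; exact: ltW.
Qed.

Section Freiman.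
Variable n : nat.
Local Notation v := (@vvec n).
Implicit Type A : {fset rat}.

(** The direction space of the affine hull of the valuation vectors. *)
Definition aff A : {vspace 'rV[rat]_n} := <<[seq v x - v y | x <- A, y <- A]>>%VS.

Lemma mem_aff A x y : x \in A -> y \in A -> v x - v y \in aff A.
Proof. by move=> xA yA; apply/memv_span/allpairs_f. Qed.

Lemma aff_subP A (W : {vspace 'rV[rat]_n}) a :
  {in A, forall x, v x - v a \in W} -> (aff A <= W)%VS.
Proof.
move=> AW; apply/span_subvP => _ /allpairsP[[x y] [/= xA yA ->]].
have -> : v x - v y = (v x - v a) - (v y - v a) by rewrite opprB addrA subrK.
by rewrite rpredB ?AW.
Qed.

(* The elements [x] of [A] with [a x] outside [A' A'] generate, together with
   [a], the affine span: if [a y = y1 y2] with [y1, y2] in [A'], then both are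
   larger than [y] in absolute value. *)
Lemma freiman_generators A a : a \in A -> {in A, forall x, x != 0} ->
  {in A, forall x, `|x| <= `|a|} ->
  let A' := [fset x in A | `|x| < `|a|] in
  exists R : {fset rat},
    [/\ {in R, forall r, exists2 x, x \in A & `|x| = r},
        {in R, forall r, {in A' &, forall y z, `|a| * r != `|y * z|}} &
        (\dim (aff A) < #|` R|)%N].
Proof.
move=> aA A0 amax A'.
have A'E x : x \in A' = (x \in A) && (`|x| < `|a|) by rewrite !inE.
pose bad r := has (fun y => has (fun z => `|a| * r == `|y * z|) A') A'.
pose R := [fset r in [fset `|x| | x in A] | ~~ bad r].
have RE r : r \in R = (r \in [fset `|x| | x in A]) && ~~ bad r by rewrite !inE.
have ap : 0 < `|a| by rewrite normr_gt0 A0.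
have aR : `|a| \in R.
  rewrite RE; apply/andP; split; first by apply/imfsetP; exists a.
  apply/hasPn => y; rewrite A'E => /andP[_ ya]; apply/hasPn => z.
  rewrite A'E => /andP[_ za]; rewrite normrM eq_sym lt_eqF //.
  by apply: ltr_pM.
exists R; split.
- by move=> r; rewrite RE => /andP[/imfsetP[x /= xA ->] _]; exists x.
- move=> r; rewrite RE => /andP[_ /hasPn nb] y z yA' zA'.
  by have /hasPn := nb y yA'; apply.
pose W := <<[seq v r - v a | r <- R `\ `|a|]>>%VS.
apply: (@leq_ltn_trans (\dim W)); last first.
  apply: leq_ltn_trans (dim_span _) _.
  by rewrite size_map [X in (_ < X)%N](cardfsD1 `|a|) aR.
apply/dimvS/(@aff_subP _ _ a) => y.
have [m] := ubnP #|` [fset x in A | `|y| < `|x|]|.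
elim: m y => // m IH y ym yA.
case: (eqVneq `|y| `|a|) => [e|ya].
  by rewrite -(vvec_norm n y) e vvec_norm subrr mem0v.
case: (boolP (`|y| \in R)) => [yR|].
  rewrite -(vvec_norm n y); apply/memv_span/map_f.
  by rewrite in_fsetD1 ya.
rewrite RE negb_and negbK => /orP[/negP[]|]; first by apply/imfsetP; exists y.
case/hasP=> y1 y1A' /hasP[y2 y2A' /eqP e].
have bigger z1 z2 : z1 \in A' -> z2 \in A' -> `|a| * `|y| = `|z1 * z2| ->
    v z1 - v a \in W.
  rewrite !A'E => /andP[z1A z1a] /andP[z2A z2a] ez.
  have yz1 : `|y| < `|z1|.
    rewrite -(ltr_pM2l ap) ez normrM mulrC ltr_pM2r //.
    by rewrite normr_gt0 A0.
  apply: IH => //; rewrite ltnS in ym; apply: leq_trans ym.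
  apply: fproper_ltn_card; rewrite fproperE; apply/andP; split.
    by apply/fsubsetP => x; rewrite !inE => /andP[-> /(lt_trans yz1)].
  by apply/fsubsetPn; exists z1; rewrite !inE /= z1A ?ltxx.
have h1 := bigger _ _ y1A' y2A' e.
have h2 : v y2 - v a \in W by apply: (bigger y2 y1) => //; rewrite e mulrC.
have vE : v a + v y = v y1 + v y2.
  move: y1A' y2A'; rewrite !A'E => /andP[/A0 y10 _] /andP[/A0 y20 _].
  rewrite -(vvecM n (A0 a aA) (A0 y yA)) -(vvecM n y10 y20).
  rewrite -(vvec_norm n (a * y)) -(vvec_norm n (y1 * y2)).
  by rewrite normrM e.
suff -> : v y - v a = (v y1 - v a) + (v y2 - v a) by rewrite rpredD.
by rewrite addrACA -vE addrACA subrr add0r.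
Qed.

(** Induction by deleting the set [S] of elements of maximal absolute value. It can have two
    elements, which doubles the classical error term. *)
Lemma freiman e A : A != fset0 -> {in A, forall x, x != 0} ->
  (e <= \dim (aff A))%N ->
  (e.+1 * #|` A| <= #|` fprod A A| + e * e.+1)%N.
Proof.
have [m] := ubnP #|` A|; elim: m e A => // m IH e A Am An A0 eA.
have [a aA amax] : exists2 a, a \in A & {in A, forall x, `|x| <= `|a|}.
  apply: (@exists_max_norm A); apply: contraNneq An => A0'.
  by apply/eqP/fsetP => x; rewrite inE -[x \in A]/(x \in (A : seq rat)) A0'.
have a0 := A0 a aA; have AA := leq_card_fprod A a0 aA.
case: e eA => [|e] eA; first by rewrite mul1n addn0.
pose A' := [fset x in A | `|x| < `|a|].
pose S := [fset x in A | `|x| == `|a|].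
have A'E x : x \in A' = (x \in A) && (`|x| < `|a|) by rewrite !inE.
have SE x : x \in S = (x \in A) && (`|x| == `|a|) by rewrite !inE.
have A'A : A' `<=` A by apply/fsubsetP => x; rewrite A'E => /andP[].
have A'0 : {in A', forall x, x != 0} by move=> x; rewrite A'E => /andP[/A0].
have aS : a \in S by rewrite SE aA eqxx.
have cA : (#|` A| = #|` S| + #|` A'|)%N.
  have dis : S `&` A' = fset0.
    apply/fsetP => x; rewrite inE SE A'E in_fset0.
    by case: eqP => [->|]; rewrite ?andbF // ltxx !andbF.
  rewrite -[RHS]subn0 -(cardfs0 rat) -dis -cardfsU; congr (#|` _|).
  apply/fsetP => x; rewrite inE SE A'E -andb_orr.
  by case: (boolP (x \in A)) => //= /amax; rewrite le_eqVlt.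
have S2 : (#|` S| <= 2)%N.
  apply: leq_trans (_ : #|` [fset a; - a]| <= _)%N; last first.
    by rewrite cardfs2; case: (_ != _).
  apply/fsubset_leq_card/fsubsetP => x; rewrite SE => /andP[_].
  by rewrite eqr_norm2 !inE.
have S1 : (0 < #|` S|)%N by rewrite cardfs_gt0; apply/fset0Pn; exists a.
have [A'e|A'n] := eqVneq A' fset0.
  move: eA; suff -> : aff A = 0%VS by rewrite dimv0.
  apply/eqP; rewrite -subv0; apply: (@aff_subP _ _ a) => x xA.
  rewrite memv0 subr_eq0 -(vvec_norm n x) -(vvec_norm n a).
  suff -> : `|x| = `|a| by [].
  apply: le_anti; rewrite amax //= leNgt; apply/negP => xa.
  by have := A'E x; rewrite A'e in_fset0 xA xa.
have A'm : (#|` A'| < m)%N by move: Am; rewrite cA; lia.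
have aA'A : (aff A' <= aff A)%VS.
  have /fset0Pn[b bA'] := A'n; apply: (@aff_subP _ _ b) => x xA'.
  by apply: mem_aff; move: (fsubsetP A'A); apply.
(* If the dimension stays above [e] after the deletion, the generators times [S] provide [|S| |R|]
   products outside [A' A']. *)
have [le|gt] := leqP e.+1 (\dim (aff A')).
  have [R [Rrep Rnew dR]] := freiman_generators aA A0 amax.
  pose rep r := if r \in A then r else - r.
  have repP : {in R, forall r, rep r \in A /\ `|rep r| = r}.
    move=> r /Rrep[x xA <-]; rewrite /rep; case: ifP => [h|h].
      by rewrite h normr_id.
    rewrite normrN normr_id; split => //.
    case: (lerP 0 x) h => [/ger0_norm|/ltr0_norm] ->; first by rewrite xA.
    by rewrite opprK.
  pose new := [seq s * rep r | s <- S, r <- R].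
  have nu : uniq (fprod A' A' ++ new).
    rewrite cat_uniq fset_uniq /=; apply/andP; split.
      apply/hasPn => _ /allpairsP[[s r] [/= sS rR ->]]; apply/negP.
      case/fprodP => y [z [yA' zA' ez]].
      have := Rnew r rR y z yA' zA'; rewrite -ez normrM.
      have [_ ->] := repP r rR; move: sS; rewrite SE => /andP[_ /eqP ->].
      by rewrite eqxx.
    apply: allpairs_uniq (fset_uniq _) (fset_uniq _) _ => p p'.
    case/allpairsP => [[s r] [/= sS rR ->]].
    case/allpairsP => [[s' r'] [/= sS' rR' ->]] /= ez.
    have [rA nr] := repP r rR; have [rA' nr'] := repP r' rR'.
    move: sS sS'; rewrite !SE => /andP[_ /eqP ns] /andP[_ /eqP ns'].
    have er : r = r'.
      apply: (@mulfI _ `|a|); first by rewrite normr_eq0.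
      by rewrite -{1}nr -{1}ns -normrM ez normrM ns' nr'.
    by rewrite -er in ez *; rewrite (mulIf (A0 _ rA) ez).
  have /uniq_leq_size : {subset fprod A' A' ++ new <= fprod A A}.
    move=> z; rewrite mem_cat => /orP[|/allpairsP[[s r] [/= sS rR ->]]].
      by apply/fsubsetP/fprodS.
    apply: mem_fprod; first by move: sS; rewrite SE => /andP[].
    by have [] := repP r rR.
  move=> /(_ nu); rewrite size_cat size_allpairs => big.
  have := IH e.+1 A' A'm A'n A'0 le.
  have : (#|` S| * e.+2 <= #|` S| * #|` R|)%N.
    by rewrite leq_mul2l (leq_ltn_trans eA dR) orbT.
  rewrite cA mulnDr [(e.+2 * #|` S|)%N]mulnC => h1 h2.
  rewrite (leq_trans (leq_add h1 h2)) // addnA leq_add2r addnC.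
  exact: big.
(* Otherwise the dimension drops by exactly one, and all products of [a] with elements of [A] are
   new. *)
have /fset0Pn[b bA'] := A'n; have bA := fsubsetP A'A b bA'.
have vab : v a - v b \notin aff A'.
  apply: contraL eA => ab; rewrite -ltnNge; apply: leq_ltn_trans gt.
  apply/dimvS/(@aff_subP _ _ b) => x xA.
  have [xa|xa] := ltrP `|x| `|a|.
    by apply: mem_aff => //; rewrite A'E xA.
  have e' : `|x| = `|a| by apply: le_anti; rewrite xa amax.
  by rewrite -(vvec_norm n x) e' vvec_norm.
have dim1 : (\dim (aff A) <= (\dim (aff A')).+1)%N.
  apply: leq_trans (_ : \dim (aff A' + <[v a - v b]>) <= _)%N.
    apply/dimvS/(@aff_subP _ _ b) => x xA; have [xa|xa] := ltrP `|x| `|a|.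
      by apply: (subvP (addvSl _ _)); apply: mem_aff => //; rewrite A'E xA.
    have e' : `|x| = `|a| by apply: le_anti; rewrite xa amax.
    apply: (subvP (addvSr _ _)).
    by rewrite -(vvec_norm n x) e' vvec_norm memv_line.
  have [le _] := dimv_add_leqif (aff A') <[v a - v b]>%VS.
  by apply: leq_trans le _; rewrite dim_vline; case: (_ != _); lia.
have IHe : (e.+1 * #|` A'| <= #|` fprod A' A'| + e * e.+1)%N.
  by apply: IH => //; lia.
pose new := [seq a * x | x <- A].
have nu : uniq (fprod A' A' ++ new).
  rewrite cat_uniq fset_uniq map_inj_uniq ?fset_uniq ?andbT /=; last exact: mulfI.
  (* A coincidence [a x = y z] with [x] in [A'] would put [v a - v b] into [aff A']; with
     [|x| = |a|] it contradicts [|y|, |z| < |a|]. *)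
  apply/hasPn => _ /mapP[x xA ->]; apply/negP => /fprodP[y [z [yA' zA' ez]]].
  have := A'E y; have := A'E z; rewrite yA' zA'.
  move=> /esym/andP[zA za] /esym/andP[yA ya].
  have [xa|xa] := ltrP `|x| `|a|.
    have xA' : x \in A' by rewrite A'E xA.
    move/negP: vab; apply.
    have vE : v a + v x = v y + v z by rewrite -!vvecM ?A0 // ez.
    have -> : v a - v b = (v y - v x) + (v z - v b).
      by rewrite addrACA -vE addrA addrK.
    by rewrite rpredD ?mem_aff.
  have : `|a| * `|a| <= `|y| * `|z|.
    by rewrite -!normrM -ez !normrM ler_wpM2l.
  by apply/negP; rewrite -ltNge; apply: ltr_pM.
have /uniq_leq_size : {subset fprod A' A' ++ new <= fprod A A}.
  move=> z; rewrite mem_cat => /orP[|/mapP[x xA ->]]; last exact: mem_fprod.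
  by apply/fsubsetP/fprodS.
move=> /(_ nu); rewrite size_cat size_map => big.
have {}big : (#|` fprod A' A'| + #|` A| <= #|` fprod A A|)%N := big.
rewrite cA in big *; nia.
Qed.

End Freiman.

(** * Combining the energy, Pluennecke and Freiman bounds *)

Lemma normq_frac (x : rat) : `|x| = (`|numq x|%N)%:~R / (`|denq x|%N)%:~R.
Proof. by rewrite -{1}(divq_num_den x) normf_div -!intr_norm !abszE. Qed.

(** With [n] above all numerators and denominators every relevant prime is a coordinate, and unique
    factorisation recovers the absolute value. *)
Lemma vvec_separates (A : seq rat) : {in A, forall x, x != 0} ->
  exists n, {in A &, forall x y, vvec n x = vvec n y -> `|x| = `|y|}.
Proof.
move=> A0; pose n := (\max_(x <- A) maxn `|numq x| `|denq x|).+1.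
have bound x : x \in A -> (`|numq x| < n)%N /\ (`|denq x| < n)%N.
  move=> xA; have : (maxn `|numq x| `|denq x| < n)%N.
    rewrite ltnS.
    exact: (@leq_bigmax_seq _ A xpredT (fun x => maxn `|numq x| `|denq x|) x).
  by rewrite gtn_max => /andP[].
exists n => x y xA yA vE; have [x0 y0] := (A0 x xA, A0 y yA).
have [nx dx] := bound x xA; have [ny dy] := bound y yA.
have pos z : z != 0 -> (0 < `|numq z|)%N by rewrite absz_gt0 numq_eq0.
have dpos z : (0 < `|denq z|)%N by rewrite absz_gt0 denq_neq0.
have key : (`|numq x| * `|denq y| = `|numq y| * `|denq x|)%N.
  apply: eqn_from_log; rewrite ?muln_gt0 ?pos ?dpos // => p.
  rewrite !lognM ?pos ?dpos //; case: (ltnP p n) => pn.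
    move/rowP/(_ (Ordinal pn)): vE; rewrite !mxE /= => /intr_inj.
    by rewrite /vq; lia.
  by rewrite !ltn_log0 // (leq_trans _ pn).
rewrite !normq_frac; apply/eqP.
by rewrite eqr_div ?intr_eq0 -?lt0n ?dpos // -!intrM -!PoszM key.
Qed.

(** Cauchy-Schwarz for the multiplicities of the [k]-fold products, whose squares sum to at most the
    energy; nonzero coordinates make each coincidence a genuine solution. *)
Lemma size_le_ener (F : fieldType) k (f : seq (F * F)) :
  {in f, forall x, x.1 != 0 /\ x.2 != 0} ->
  (size f ^ (2 * k) <= size (undup (prods (nseq k f))) * ener k f)%N.
Proof.
move=> f0; set P := prods (nseq k f).
have P0 : {in P, forall x, x.1 != 0 /\ x.2 != 0}.
  rewrite /P; elim: k {P} => [|k IH] x /=.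
    by rewrite inE => /eqP ->; split; exact: oner_neq0.
  case/allpairsP=> -[y z] /= [/f0[y1 y2] /IH[z1 z2] ->] /=.
  by rewrite !mulf_neq0.
have sP : (size f ^ k)%N = size P.
  by rewrite (size_prods (f := f)) ?size_nseq // all_nseq eqxx orbT.
have E : (\sum_(z <- undup P) count_mem z P ^ 2 <= ener k f)%N.
  have -> : ener k f = nsol (nseq k f ++ map (@conj F) (nseq k f)).
    by rewrite map_nseq.
  rewrite /nsol sum_prods_cat prods_conj -/P.
  under eq_bigr => z _ do rewrite -mulnn.
  rewrite -(@sum_count_super _ P) ?undup_uniq //; last first.
    by move=> z; rewrite mem_undup.
  rewrite [X in (X <= _)%N]big_seq [X in (_ <= X)%N]big_seq.
  apply: leq_sum => x xP; rewrite big_map -sum1_count big_mkcond /=.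
  apply: leq_sum => y _; case: eqP => // ->.
  have [x1 x2] := P0 x xP.
  suff -> : x * pinv x = 1 by rewrite eqxx.
  by rewrite /pinv; case: (x) x1 x2 => a b /= a0 b0; congr pair; rewrite divff.
have C : size P = (\sum_(z <- undup P) 1 * count_mem z P)%N.
  rewrite -sum1_size (@sum_count_super _ P (undup P)) ?undup_uniq //.
    by apply: eq_bigr => z _; rewrite muln1 mul1n.
  by move=> z; rewrite mem_undup.
rewrite mulnC expnM sP {1}C; apply: leq_trans (cauchy_schwarz_nat _ _ _) _.
by apply: leq_mul E; rewrite -sum1_size; apply: leq_sum.
Qed.

(** Here [d] is the affine dimension; Freiman's bound is kept for all [e <= d] because it will be
    applied with [e] close to [K]. *)
Lemma shifted_products (X : {fset rat}) k : X != fset0 -> (0 < k)%N ->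
  {in X, forall x, x != 0 /\ 1 + x != 0} ->
  exists d, (forall e, e <= d ->
      e.+1 * #|` X| <= #|` fprod X X| + e * e.+1)%N /\
    (#|` X| ^ (2 * k) <= #|` fpow [fset (1 + x)%R | x in X] k| *
       (2 * (2 * 'C(2 * k, 2)) ^ d) ^ k * (#|` fprod X X| ^ k * #|` X|))%N.
Proof.
move=> Xn k0 X01; set Y := [fset 1 + x | x in X].
have X0 : {in X, forall x, x != 0} by move=> x /X01[].
have [n sep] := vvec_separates X0; exists (\dim (aff n X)).
split=> [e|]; first exact: freiman.
have EB := ener_dim k0 (fset_uniq X) X0 sep (@mem_aff n X) (leqnn _).
have := @size_le_ener _ k (map lift2 X); rewrite size_map => /(_ _)/leq_trans.
apply; first by move=> _ /mapP[x /X01[x0 x1] ->].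
have pairs : (size (undup (prods (nseq k (map lift2 X)))) <=
              #|` fpow Y k| * #|` fpow X k|)%N.
  rewrite mulnC -(size_allpairs pair); apply: uniq_leq_size (undup_uniq _) _.
  move=> z; rewrite mem_undup; elim: k {k0 EB} z => [|k IH] z /=.
    by rewrite inE => /eqP ->; apply/allpairsP; exists (1, 1); rewrite !fset11.
  case/allpairsP=> -[x y] /= [/mapP[a aX ->] /IH].
  case/allpairsP=> -[b c] /= [bX cY ->] ->; apply/allpairsP.
  exists (b * a, c * (1 + a)); split => /=; try apply: mem_fprod => //.
    by apply/imfsetP; exists a.
  by rewrite [b * a]mulrC [c * _]mulrC.
apply: leq_trans (leq_mul pairs EB) _.
rewrite expnMn -!mulnA leq_mul2l; apply/orP; right.
rewrite mulnCA leq_mul2l; apply/orP; right; exact: plunnecke.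
Qed.

(** * Reduction to the shift by [1] *)

Section Transfer.
Variables (A : seq rat) (u : rat).
Hypotheses (uA : uniq A) (u0 : u != 0).

(** The excluded values [0] and [-1] are those where [lift2] has a zero coordinate. *)
Definition dilate : {fset rat} :=
  [fset x in [seq a / u | a <- A] | (x != 0) && (1 + x != 0)].

Lemma dilateP x :
  reflect (exists2 a, a \in A & x = a / u /\ x != 0 /\ 1 + x != 0) (x \in dilate).
Proof.
have -> : x \in dilate = (x \in [seq a / u | a <- A]) && ((x != 0) && (1 + x != 0)).
  by rewrite !inE.
apply: (iffP andP) => [[/mapP[a aA ->] /andP[h1 h2]]|[a aA [-> [-> ->]]]].
  by exists a.
by split=> //; exact: map_f.
Qed.

Lemma dilate_mul x : x \in dilate -> x * u \in A /\ (1 + x) * u \in shift A u.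
Proof.
case/dilateP=> a aA [-> _]; rewrite mulrDl mul1r divfK //; split => //.
by rewrite mem_undup addrC; exact: (map_f (fun a => a + u)).
Qed.

Lemma size_le_dilate : (size A <= #|` dilate| + 2)%N.
Proof.
pose t := [seq x * u | x <- dilate] ++ [:: 0; - u].
have -> : (#|` dilate| + 2 = size t)%N by rewrite size_cat size_map.
apply: uniq_leq_size => // a aA; rewrite mem_cat !inE.
have [->|a0] := eqVneq a 0; first by rewrite ?eqxx !orbT.
have [->|au] := eqVneq a (- u); first by rewrite ?eqxx !orbT.
rewrite !orbF -(divfK u0 a); apply: map_f; apply/dilateP; exists a => //.
split=> //; split; first by rewrite mulf_neq0 ?invr_eq0.
apply: contraNneq au => e; rewrite -addr_eq0 addrC -{1}(mul1r u) -(divfK u0 a).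
by rewrite -mulrDl e mul0r.
Qed.

Lemma dilate_le : (#|` dilate| <= size A)%N.
Proof.
rewrite -(size_map (fun x => x * u)); apply: uniq_leq_size.
  by rewrite map_inj_uniq ?fset_uniq //; exact: mulIf.
by move=> _ /mapP[x /dilate_mul[xA _] ->].
Qed.

Lemma dilate_prod : (#|` fprod dilate dilate| <= ncard (prodset A A))%N.
Proof.
rewrite /ncard undup_id ?undup_uniq // -(size_map (fun x => x * (u * u))).
apply: uniq_leq_size.
  by rewrite map_inj_uniq ?fset_uniq //; apply: mulIf; rewrite mulf_neq0.
move=> _ /mapP[z /fprodP[x [y [/dilate_mul[xA _] /dilate_mul[yA _] ->]]] ->].
by rewrite mem_undup mulrACA; exact: allpairs_f.
Qed.

Lemma dilate_shift k : (0 < k)%N ->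
  (#|` fpow [fset (1 + x)%R | x in dilate] k| <= ncard (kprod (shift A u) k))%N.
Proof.
move=> k0; set Y := [fset 1 + x | x in dilate].
have Yu y : y \in Y -> y * u \in shift A u.
  by case/imfsetP=> x /= /dilate_mul[_ h] ->.
rewrite /ncard -(size_map (fun x => x * u ^+ k)); apply: uniq_leq_size.
  by rewrite map_inj_uniq ?fset_uniq //; apply: mulIf; rewrite expf_neq0.
move=> _ /mapP[z zY ->]; rewrite mem_undup; case: k k0 z zY => // k _.
elim: k => [|k IH] z /fprodP[x [y [xY yY ->]]].
  by move/fset1P: xY => ->; rewrite mul1r /= mem_undup Yu.
rewrite exprSr mulrACA /=; rewrite mem_undup.
by apply: allpairs_f; [exact: IH | exact: Yu].
Qed.

(** This yields [1 <= K]. Multiplication by a nonzero element of [A] is injective; if there is none,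
    [A] has no element but [0]. *)
Lemma leq_prodset : (size A <= ncard (prodset A A))%N.
Proof.
rewrite /ncard undup_id ?undup_uniq //.
case: (boolP (has (fun a => a != 0) A)) => [/hasP[a aA a0]|].
  rewrite -(size_map (fun x => a * x)); apply: uniq_leq_size.
    by rewrite map_inj_uniq //; exact: mulfI.
  by move=> _ /mapP[x xA ->]; rewrite mem_undup; exact: allpairs_f.
move/hasPn => A0; apply: uniq_leq_size => // a aA.
have /negPn/eqP a0 := A0 a aA; rewrite a0 mem_undup.
by apply/allpairsP; exists (a, a); rewrite /= a0 mulr0 -{1 2}a0.
Qed.

Lemma kprod_shift_gt0 k : A != [::] -> (0 < ncard (kprod (shift A u) k))%N.
Proof.
move=> An; have [a aA] : exists a, a \in A.
  by case: (A) An => // a s _; exists a; exact: mem_head.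
have hu : a + u \in shift A u by rewrite mem_undup; exact: (map_f (fun a => a + u)).
have [z zk] : exists z, z \in kprod (shift A u) k.
  elim: k => [|[|k] [z IH]] /=; first by exists 1; rewrite mem_head.
    by exists (a + u); rewrite mem_undup.
  by exists (z * (a + u)); rewrite mem_undup; apply: allpairs_f.
by rewrite /ncard lt0n size_eq0; apply: contraTneq zk; rewrite -mem_undup => ->.
Qed.

End Transfer.

(* Real estimates and the final computation *)
From Stdlib Require Import Reals Lra.
Local Close Scope ring_scope.
Local Close Scope fset_scope.

Lemma INR_leq m n : m <= n -> (INR m <= INR n)%R.
Proof. by move/ssrnat.leP; exact: le_INR. Qed.

Lemma INR_addn m n : INR (m + n) = (INR m + INR n)%R.
Proof. exact: plus_INR. Qed.

Lemma INR_muln m n : INR (m * n) = (INR m * INR n)%R.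
Proof. exact: mult_INR. Qed.

Lemma INR_expn m n : INR (expn m n) = (INR m ^ n)%R.
Proof. by elim: n => //= n IH; rewrite expnS INR_muln IH. Qed.

Lemma Rpower_natmul x y k : (0 < x)%R -> Rpower x (y * INR k) = (Rpower x y ^ k)%R.
Proof. by move=> x0; rewrite -Rpower_mult Rpower_pow //; apply: exp_pos. Qed.

(** Since [ln 30 >= 3], [Rpower 30 (K - 1)] is at least the cube of [exp (K - 1)], and
    [exp (K - 1) >= K]. The cubic growth will beat Freiman's quadratic error. *)
Lemma Rpower_30_ge K : (1 <= K)%R -> (30 * (K * K * K) <= Rpower 30 K)%R.
Proof.
move=> K1; have -> : Rpower 30 K = (30 * Rpower 30 (K - 1))%R.
  rewrite -{2}(Rpower_1 30); last by lra.
  by rewrite -Rpower_plus; congr Rpower; ring.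
have e0 : (K <= exp (K - 1))%R by have := exp_ineq1_le (K - 1); lra.
have l3 : (1 <= ln 3)%R.
  apply: Rnot_lt_le => h; have := exp_increasing _ _ h.
  by rewrite exp_ln; have := exp_le_3; lra.
have l30 : (3 <= ln 30)%R.
  have h : (ln 27 = 3 * ln 3)%R.
    have -> : (27 = 3 * (3 * 3))%R by lra.
    by rewrite !ln_mult; lra.
  have : (ln 27 < ln 30)%R by apply: ln_increasing; lra.
  by lra.
have e3 : (exp (K - 1) * exp (K - 1) * exp (K - 1) <= Rpower 30 (K - 1))%R.
  rewrite -!exp_plus /Rpower.
  have : (K - 1 + (K - 1) + (K - 1) <= (K - 1) * ln 30)%R by nra.
  by case=> [h|->]; [have := exp_increasing _ _ h|]; lra.
have e2 : (K * K <= exp (K - 1) * exp (K - 1))%R by nra.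
by nra.
Qed.

(** For [k >= 3] the base on the right is at least [30]; for [k = 2] it is [12], and [30 <= 144]. *)
Lemma pow30_le k : 2 <= k -> expn 30 (k - 1) <= expn (2 * 'C(2 * k, 2)) k.
Proof.
case: k => // -[//|[|k]] _; first by [].
apply: (@leq_trans (expn (2 * 'C(2 * k.+3, 2)) (k.+3 - 1))); last first.
  by rewrite leq_pexp2l ?leq_subr // muln_gt0 bin_gt0; lia.
by rewrite leq_exp2r //; rewrite bin2 -divn2; lia.
Qed.

(** Lets Freiman's lemma be used at dimension about [K]: at [d] itself the error term could be too
    large. *)
Lemma exists_near_nat (K : R) d : (1 <= K)%R -> (K - / 2 <= INR d)%R ->
  exists e, e <= d /\ (K - / 2 <= INR e < K + / 2)%R.
Proof.
move=> K1; elim: d => [|d IH]; first by rewrite /=; lra.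
rewrite S_INR => h; case: (Rle_lt_dec (K - / 2) (INR d)) => [/IH[e [ed he]]|lt].
  by exists e; split=> //; exact: leqW.
by exists d.+1; rewrite S_INR; split=> //; lra.
Qed.

Theorem mainTheorem14 (A : seq rat) (K : R) (u : rat) (k : nat) :
  uniq A ->
  (INR (ncard (prodset A A)) <= K * INR (ncard A))%R ->
  u != @GRing.zero rat ->
  (2 <= k)%N ->
  (INR (ncard A) ^ (k - 1) /
     (K ^ k * Rpower (2 * INR 'C(2 * k, 2)) (K * INR k))
   <= INR (ncard (kprod (shift A u) k)))%R.
Proof.
move=> uA; have -> : ncard A = size A by rewrite /ncard undup_id.
move=> hK u0 k2.
set S := ncard (kprod _ _).
have [->|An] := eqVneq A [::].
  rewrite /= pow_i; last by apply/ssrnat.ltP; lia.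
  by rewrite /Rdiv Rmult_0_l; exact: pos_INR.
have n1 : (1 <= INR (size A))%R.
  by rewrite -[1%R]/(INR 1); apply: INR_leq; rewrite lt0n size_eq0.
have K1 : (1 <= K)%R.
  apply: (Rmult_le_reg_r (INR (size A))); first by lra.
  by have := INR_leq (leq_prodset uA); lra.
have S1 : (1 <= INR S)%R.
  by rewrite -[1%R]/(INR 1); apply: INR_leq; exact: kprod_shift_gt0.
set C := 2 * 'C(2 * k, 2).
have CE : (2 * INR 'C(2 * k, 2) = INR C)%R by rewrite /C INR_muln.
have C12 : (12 <= INR C)%R.
  rewrite (_ : 12%R = INR 12); last by rewrite /=; ring.
  by apply: INR_leq; rewrite /C bin2 -divn2; nia.
rewrite CE Rpower_natmul; last by lra.
set Q := Rpower (INR C) K; have Q0 : (0 < Q)%R by exact: exp_pos.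
have KQ0 : (0 < K ^ k * Q ^ k)%R.
  by apply: Rmult_lt_0_compat; apply: pow_lt; lra.
suff main : (INR (size A) ^ (k - 1) <= INR S * (K ^ k * Q ^ k))%R.
  apply: (Rmult_le_reg_r (K ^ k * Q ^ k)) => //.
  by rewrite /Rdiv Rmult_assoc Rinv_l ?Rmult_1_r //; lra.
(* For small [A] the claimed bound is at most [1]: [|A|^(k-1) <= 30^(K (k-1)) <= C^(K k)]. *)
case: (Rle_lt_dec (INR (size A)) (Rpower 30 K)) => [small|large].
  have h1 : (INR (size A) ^ (k - 1) <= Q ^ k)%R.
    apply: Rle_trans (_ : Rpower 30 K ^ (k - 1) <= _)%R.
      by apply: pow_incr; lra.
    rewrite -!Rpower_natmul; try lra.
    rewrite ![(K * INR _)%R]Rmult_comm -!Rpower_mult !Rpower_pow; try lra.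
    apply: Rle_Rpower_l; first by lra.
    split; first by apply: pow_lt; lra.
    rewrite -INR_expn (_ : 30%R = INR 30); last by rewrite /=; ring.
    by rewrite -INR_expn; apply: INR_leq; exact: pow30_le.
  have h2 : (1 <= K ^ k)%R by apply: pow_R1_Rle.
  have h3 : (0 < Q ^ k)%R by apply: pow_lt.
  have h4 : (Q ^ k <= K ^ k * Q ^ k)%R by nra.
  by nra.
have k0 : 0 < k by lia.
have big := Rpower_30_ge K1.
set X := dilate A u; set n0 := INR (size A) in hK n1 large *.
have Nlo : (n0 - 2 <= INR #|` X|)%R.
  have := INR_leq (size_le_dilate uA u0); rewrite INR_addn -/n0 -/X.
  by rewrite (_ : INR 2 = 2%R) //; lra.
have Nhi : (INR #|` X| <= n0)%R by apply: INR_leq; exact: dilate_le.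
have n30 : (30 < n0)%R by nra.
have Xn : X != fset0%fset.
  by apply/eqP => X0; move: Nlo; rewrite X0 cardfs0 /=; lra.
have [|d [frei prod]] := @shifted_products X k Xn k0.
  by move=> x /dilateP[a _ [_ [x0 x1]]].
set N := INR #|` X| in Nlo Nhi; set P := INR #|` fprod X X|.
have hP : (P <= K * n0)%R.
  by apply: Rle_trans hK; apply: INR_leq; exact: dilate_prod.
have P0 : (0 <= P)%R by exact: pos_INR.
(* Otherwise Freiman's lemma at an [e] with [e + 1 - K >= 1/2] gives [n0 / 2 <= (e + 1) (e + 2)],
   quadratic in [K], against [n0 > 30 K^3]. *)
have dK : (INR d + / 2 <= K)%R.
  apply: Rnot_lt_le => lt; have [|e [ed he]] := @exists_near_nat K d K1; first by lra.
  have := INR_leq (frei e ed); rewrite INR_addn !INR_muln S_INR -/N -/P.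
  have e0 := pos_INR e.
  have h1 : ((INR e + 1) * (n0 - 2) <= (INR e + 1) * N)%R by nra.
  have h2 : ((INR e + 1) * (INR e + 2) <= (K + 3 / 2) * (K + 5 / 2))%R by nra.
  have h3 : (/ 2 * n0 <= (INR e + 1 - K) * n0)%R by nra.
  have h4 : (2 * (K + 3 / 2) * (K + 5 / 2) < 30 * (K * K * K))%R by nra.
  by nra.
set q := (INR C ^ d)%R.
have q0 : (0 < q)%R by apply: pow_lt; lra.
(* The spare exponent [1/2] yields [sqrt C >= 3], enough to absorb [2] times the ratio [225 / 196]
   below. *)
have Qq : (3 * q <= Q)%R.
  apply: Rle_trans (_ : Rpower (INR C) (INR d + / 2) <= _)%R; last first.
    by apply: Rle_Rpower; lra.
  rewrite Rpower_plus Rpower_pow ?Rpower_sqrt -/q; try lra.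
  have : (3 <= sqrt (INR C))%R.
    by rewrite -(sqrt_square 3); [apply: sqrt_le_1|]; lra.
  by nra.
have sS := INR_leq (dilate_shift A u0 k0); rewrite -/X -/S in sS.
have := INR_leq prod; rewrite !INR_muln !INR_expn !INR_muln !INR_expn.
rewrite -/C -/N -/P -/q (_ : INR 2 = 2%R) // => {}prod.
have N0 : (0 < N)%R by lra.
set s := INR _ in prod sS.
(* From [n0 > 30] one has [N >= n0 - 2 >= (14 / 15) n0], and [225 / 196] is the square of
   [15 / 14]. *)
have n0N : (n0 * n0 <= 225 / 196 * (N * N))%R by nra.
(* This is the goal multiplied by [n0 ^ (k + 1)]. *)
have low : (n0 ^ (2 * k) <= INR S * (K ^ k * Q ^ k) * (n0 ^ k * n0))%R.
  have -> : (n0 ^ (2 * k) = (n0 * n0) ^ k)%R.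
    by rewrite pow_mult /=; congr (_ ^ _)%R; ring.
  apply: Rle_trans (_ : (225 / 196 * (N * N)) ^ k <= _)%R.
    by apply: pow_incr; nra.
  rewrite Rpow_mult_distr.
  have -> : ((N * N) ^ k = N ^ (2 * k))%R.
    by rewrite pow_mult /=; congr (_ ^ _)%R; ring.
  have c0 : (0 < (225 / 196) ^ k)%R by apply: pow_lt; lra.
  apply: Rle_trans (Rmult_le_compat_l _ _ _ (Rlt_le _ _ c0) prod) _.
  have -> : ((225 / 196) ^ k * (s * (2 * q) ^ k * (P ^ k * N)) =
             s * ((225 / 196 * (2 * q) * P) ^ k * N))%R.
    by rewrite !Rpow_mult_distr; ring.
  have -> : (INR S * (K ^ k * Q ^ k) * (n0 ^ k * n0) =
             INR S * ((Q * (K * n0)) ^ k * n0))%R.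
    by rewrite !Rpow_mult_distr; ring.
  have s0 : (0 <= s)%R by exact: pos_INR.
  have b0 : (0 <= 225 / 196 * (2 * q) * P)%R by nra.
  apply: Rmult_le_compat => //.
    by apply: Rmult_le_pos; [apply: pow_le | lra].
  apply: Rmult_le_compat; [exact: pow_le | lra | | exact: Nhi].
  apply: pow_incr; split=> //.
  by apply: Rmult_le_compat => //; nra.
have m0 : (0 < n0 ^ k * n0)%R.
  by apply: Rmult_lt_0_compat; [apply: pow_lt|]; lra.
apply: (Rmult_le_reg_r _ _ _ m0); apply: Rle_trans low.
apply: Req_le; have -> : 2 * k = Nat.add (k - 1) (Nat.add k 1) by lia.
by rewrite !pow_add pow_1.
Qed.
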